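(* Let $\Bbbk$ be a field of characteristic zero, $H=\Bbbk[\partial]$, and let $\mathfrak g$ be a Lie algebra over $\Bbbk$ with a linear basis $X$. Then the specific defining relations of $H\otimes P(\mathfrak g)$ as of a conformal module over $U(\mathrm{Cur}\,\mathfrak g,N=3)$ (generated by the single element $1=1\otimes1$) are $$L_n^a1=0,\qquad a\in X,\ n=0,2,3,\dots.$$
   Context: Associative conformal algebra: a left $H$-module $C$ with a bilinear operation $(\cdot\,{}_{(\lambda)}\,\cdot):C\otimes C\to C[\lambda]$ such that $(\partial a\,{}_{(\lambda)}b)=-\lambda(a\,{}_{(\lambda)}b)$, $(a\,{}_{(\lambda)}\partial b)=(\partial+\lambda)(a\,{}_{(\lambda)}b)$, $(a\,{}_{(\lambda)}(b\,{}_{(\mu)}c))=((a\,{}_{(\lambda)}b)\,{}_{(\lambda+\mu)}c)$; a left conformal module over $C$ satisfies the same identities. The current Lie conformal algebra is $\mathrm{Cur}\,\mathfrak g=H\otimes\mathfrak g$ with sesqui-linear bracket determined by $[a\,{}_{(\lambda)}b]=[a,b]$, $a,b\in\mathfrak g$. $U(\mathrm{Cur}\,\mathfrak g,N=3)$ is the universal enveloping associative conformal algebra of $\mathrm{Cur}\,\mathfrak g$ relative to the locality level $3$ on $\mathfrak g$: the associative conformal algebra generated by $X$ (equivalently, by the space $\mathfrak g$) with $\deg_\lambda(a\,{}_{(\lambda)}b)<3$ and $(a\,{}_{(\lambda)}b)-(b\,{}_{(-\lambda-\partial)}a)=[a,b]$ for $a,b\in X$, universal with these properties. $P(\mathfrak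 g)=\mathrm{gr}\,U(\mathfrak g)$ is the Poisson enveloping algebra of $\mathfrak g$: the associated graded algebra of $U(\mathfrak g)$ (isomorphic to the symmetric algebra of $\mathfrak g$), with the Poisson bracket $\{\cdot,\cdot\}$ extending the Lie product of $\mathfrak g$ by the Leibniz rule. The free $H$-module $H\otimes P(\mathfrak g)$ is a conformal module over $U(\mathrm{Cur}\,\mathfrak g,N=3)$ via $(a\,{}_{(\lambda)}w)=\{a,w\}+\lambda aw$ for $a\in\mathfrak g$, $w\in P(\mathfrak g)$, extended by $(f(\partial)a\,{}_{(\lambda)}g(\partial)w)=f(-\lambda)g(\partial+\lambda)(a\,{}_{(\lambda)}w)$. In a conformal module over $U(\mathrm{Cur}\,\mathfrak g,N=3)$ the operators $L_n^a$, $a\in X$, are defined by $(a\,{}_{(\lambda)}w)=\sum_{n\ge0}\frac{\lambda^n}{n!}L_n^aw$. The defining relations statement means: $H\otimes P(\mathfrak g)$ is the universal conformal $U(\mathrm{Cur}\,\mathfrak g,N=3)$-module generated by one element satisfying these relations, i.e., the relations hold for $1$ and for every conformal $U(\mathrm{Cur}\,\mathfrak g,N=3)$-module $V$ and $v\in V$ with $L_n^av=0$ for all $a\in X$, $n\in\{0,2,3,\dots\}$, there is a unique homomorphism of conformal modules $H\otimes P(\mathfrak g)\to V$ sending $1$ to $v$. *)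

(* Defs.v *)
From HB Require Import structures.
From mathcomp Require Import all_boot all_algebra.

Set Implicit Arguments.
Unset Strict Implicit.
Unset Printing Implicit Defensive.

Import GRing.Theory.
Local Open Scope ring_scope.

(** * Lie algebras, linear bases *)

Section Lie.
Variables (k : fieldType) (g : lmodType k).

Definition is_bilinear (U V W : lmodType k) (f : U -> V -> W) : Prop :=
  (forall x, linear (f x)) /\ (forall y, linear (f^~ y)).

Definition is_lie_bracket (br : g -> g -> g) : Prop :=
  [/\ is_bilinear br,
      forall x, br x x = 0
    & forall x y z, br x (br y z) + br y (br z x) + br z (br x y) = 0].

Definition is_linear_basis (X : g -> Prop) : Prop :=
  (forall (s : seq g) (c : g -> k), uniq s -> (forall x, x \in s -> X x) ->
     \sum_(x <- s) c x *: x = 0 -> forall x, x \in s -> c x = 0)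
  /\ (forall y, exists (s : seq g) (c : g -> k),
       (forall x, x \in s -> X x) /\ y = \sum_(x <- s) c x *: x).

End Lie.

(** * Conformal algebras and modules

   [H = k[d]] is [{poly k}], with [d = 'X].  A polynomial in [lambda] with
   coefficients in an [H]-module [V] is given by its coefficient sequence
   [nat -> V], required to vanish from some index on: [act a v n] is the
   coefficient of [lambda^n] in [(a _(lambda) v)]. *)

Section Conformal.
Variable k : fieldType.
Implicit Types V W : lmodType {poly k}.

Definition lambda_mul V (p : nat -> V) (n : nat) : V :=
  if n is m.+1 then p m else 0.

Definition deg_lt V (p : nat -> V) (N : nat) : Prop :=
  forall n, (N <= n)%N -> p n = 0.

Definition is_sesquilinear V W (act : V -> W -> nat -> W) : Prop :=
  [/\ forall a v, exists N, deg_lt (act a v) N,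
      forall c a b v n,
        act (c%:P *: a + b) v n = c%:P *: act a v n + act b v n,
      forall c a v w n,
        act a (c%:P *: v + w) n = c%:P *: act a v n + act a w n,
      forall a v n, act ('X *: a) v n = - lambda_mul (act a v) n
    & forall a v n,
        act a ('X *: v) n = 'X *: act a v n + lambda_mul (act a v) n].

(* The coefficients of [lambda^m mu^n] in
   [(a _(lambda) (b _(mu) v)) = ((a _(lambda) b) _(lambda+mu) v)];
   on the right, [(lambda+mu)^j] is expanded by the binomial formula. *)
Definition is_conf_assoc V W (prod : V -> V -> nat -> V)
    (act : V -> W -> nat -> W) : Prop :=
  forall a b v m n,
    act a (act b v n) m =
    \sum_(i < m.+1) act (prod a b i) v (m - i + n)%N *+ 'C(m - i + n, n).

Record assocConfAlg := AssocConfAlg {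
  conf_sort :> lmodType {poly k};
  conf_prod : conf_sort -> conf_sort -> nat -> conf_sort;
  conf_prod_sesquilinear : is_sesquilinear conf_prod;
  conf_prod_assoc : is_conf_assoc conf_prod conf_prod }.

Definition is_conf_module (C : assocConfAlg) V (act : C -> V -> nat -> V) :
    Prop :=
  is_sesquilinear act /\ is_conf_assoc (@conf_prod C) act.

Definition is_conf_alg_hom (A B : assocConfAlg) (f : A -> B) : Prop :=
  linear f /\
  forall a b n, f (conf_prod a b n) = conf_prod (f a) (f b) n.

Definition is_conf_module_hom (C : assocConfAlg) V W
    (actV : C -> V -> nat -> V) (actW : C -> W -> nat -> W) (f : V -> W) :
    Prop :=
  linear f /\ forall a v n, f (actV a v n) = actW a (f v) n.

(* The coefficient of [lambda^n] in
   [(a _(lambda) b) - (b _(-lambda-d) a)], provided the degree in [lambda] of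
   [(b _(lambda) a)] is less than [N]; [d] acts on the coefficients, so that
   [(-lambda-d)^j] contributes [(-1)^j C(j,n) d^(j-n)] to [lambda^n]. *)
Definition conf_commutator (A : assocConfAlg) (N : nat) (a b : A) (n : nat) :
    A :=
  conf_prod a b n
  - \sum_(j < N | (n <= j)%N)
      ((-1) ^+ j *+ 'C(j, n) * 'X^(j - n)) *: conf_prod b a j.

Definition conf_generates (A : assocConfAlg) (G : A -> Prop) : Prop :=
  forall S : A -> Prop,
    (forall a, G a -> S a) -> S 0 ->
    (forall a b, S a -> S b -> S (a + b)) ->
    (forall (h : {poly k}) a, S a -> S (h *: a)) ->
    (forall a b n, S a -> S b -> S (conf_prod a b n)) ->
    forall a, S a.

Definition conf_module_generated (C : assocConfAlg) V
    (act : C -> V -> nat -> V) (v : V) : Prop :=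
  forall S : V -> Prop,
    S v -> S 0 ->
    (forall x y, S x -> S y -> S (x + y)) ->
    (forall (h : {poly k}) x, S x -> S (h *: x)) ->
    (forall a x n, S x -> S (act a x n)) ->
    forall x, S x.

(** ** The universal enveloping associative conformal algebra of [Cur g] *)

Variables (g : lmodType k) (br : g -> g -> g) (X : g -> Prop).

(* [j] is [k]-linear, where [k] acts on [A] through [k -> k[d]]; it extends
   uniquely to an [H]-linear map on [Cur g = H (x) g]. *)
Definition is_cur_rep (N : nat) (A : assocConfAlg) (j : g -> A) : Prop :=
  [/\ forall (c : k) x y, j (c *: x + y) = c%:P *: j x + j y,
      forall a b, X a -> X b -> deg_lt (conf_prod (j a) (j b)) N
    & forall a b, X a -> X b -> forall n,
        conf_commutator N (j a) (j b) n = if n == 0 then j (br a b) else 0].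

Definition is_cur_envelope (N : nat) (U : assocConfAlg) (iota : g -> U) :
    Prop :=
  [/\ is_cur_rep N iota,
      conf_generates (fun u => exists2 a, X a & u = iota a)
    & forall (A : assocConfAlg) (j : g -> A), is_cur_rep N j ->
        exists f : U -> A,
          [/\ is_conf_alg_hom f, forall x, f (iota x) = j x
            & forall f' : U -> A, is_conf_alg_hom f' ->
                (forall x, f' (iota x) = j x) -> f' =1 f]].

End Conformal.

(** * The Poisson enveloping algebra [P(g) = gr U(g)] *)

Section Envelope.
Variables (k : fieldType) (g : lmodType k) (br : g -> g -> g).

Definition is_lie_rep (A : algType k) (j : g -> A) : Prop :=
  linear j /\ forall x y, j (br x y) = j x * j y - j y * j x.

Definition is_alg_hom (A B : algType k) (f : A -> B) : Prop :=
  linear f /\ monoid_morphism f.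

Definition is_lie_envelope (A : algType k) (iota : g -> A) : Prop :=
  is_lie_rep iota /\
  forall (B : algType k) (j : g -> B), is_lie_rep j ->
    exists f : A -> B,
      [/\ is_alg_hom f, forall x, f (iota x) = j x
        & forall f' : A -> B, is_alg_hom f' ->
            (forall x, f' (iota x) = j x) -> f' =1 f].

(* The span of the products of at most [n] elements of [iota g]. *)
Definition canonical_filtration (A : algType k) (iota : g -> A) (n : nat)
    (x : A) : Prop :=
  exists s : seq (k * seq g),
    all (fun t => (size t.2 <= n)%N) s
    /\ x = \sum_(t <- s) t.1 *: \prod_(a <- t.2) iota a.

(* [P] is the direct sum of the spaces [F n / F n.-1] (where [F (-1) = 0]),
   with the multiplication induced by that of [A]; [sigma n] is the map
   [F n -> F n / F n.-1 -> P], and its values outside [F n] are irrelevant. *)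
Definition is_assoc_graded (A : algType k) (F : nat -> A -> Prop)
    (P : algType k) (sigma : nat -> A -> P) : Prop :=
  [/\ forall n (c : k) x y, F n x -> F n y ->
        sigma n (c *: x + y) = c *: sigma n x + sigma n y,
      forall n x, F n x ->
        (sigma n x = 0 <-> if n is m.+1 then F m x else x = 0),
      sigma 0%N 1 = 1 /\
      (forall m n x y, F m x -> F n y ->
        sigma (m + n)%N (x * y) = sigma m x * sigma n y),
      forall p, exists (N : nat) (x : nat -> A),
        (forall n, F n (x n)) /\ p = \sum_(n < N) sigma n (x n)
    & forall (N : nat) (x : nat -> A), (forall n, F n (x n)) ->
        \sum_(n < N) sigma n (x n) = 0 ->
        forall n, (n < N)%N -> sigma n (x n) = 0].

(* [e : g -> P] is the degree one embedding. *)
Definition is_poisson_extension (P : algType k) (e : g -> P)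
    (pb : P -> P -> P) : Prop :=
  [/\ is_lie_bracket pb,
      forall x y z, pb x (y * z) = pb x y * z + y * pb x z
    & forall a b, pb (e a) (e b) = e (br a b)].

End Envelope.

(** * The free [H]-module [H (x) P]

   It is realized as [P[d]], i.e. [{poly P}], the scalars [k[d]] acting through
   [k[d] -> P[d]].  The alias separates this [{poly k}]-module structure from
   the [P]-module structure of [{poly P}]. *)

Definition Htensor (k : fieldType) (P : algType k) : Type := {poly P}.

Section Htensor.
Variables (k : fieldType) (P : algType k).

HB.instance Definition _ := GRing.Zmodule.on (Htensor P).

Definition Hscale (h : {poly k}) (p : Htensor P) : Htensor P :=
  map_poly (in_alg P) h * (p : {poly P}).

Fact HscaleA h1 h2 p : Hscale h1 (Hscale h2 p) = Hscale (h1 * h2) p.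
Proof. by rewrite /Hscale rmorphM mulrA. Qed.

Fact Hscale1 : left_id 1 Hscale.
Proof. by move=> p; rewrite /Hscale rmorph1 mul1r. Qed.

Fact HscaleDr : right_distributive Hscale +%R.
Proof. by move=> h p q; rewrite /Hscale mulrDr. Qed.

Fact HscaleDl p : {morph Hscale^~ p : h1 h2 / h1 + h2}.
Proof. by move=> h1 h2; rewrite /Hscale rmorphD mulrDl. Qed.

HB.instance Definition _ := GRing.Zmodule_isLmodule.Build {poly k} (Htensor P)
  HscaleA Hscale1 HscaleDr HscaleDl.

(* [1 (x) w] *)
Definition Hten (w : P) : Htensor P := (w%:P : {poly P}).

End Htensor.

(** * The module [H (x) P(g)] and its relations *)

Section Module.
Variables (k : fieldType) (g : lmodType k) (U : assocConfAlg k) (iota : g -> U).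

(* [(a _(lambda) v) = sum_n lambda^n / n! L_n^a v]. *)
Definition Lop (V : lmodType {poly k}) (act : U -> V -> nat -> V)
    (n : nat) (a : g) (v : V) : V :=
  act (iota a) v n *+ n`!.

Definition killed_by_relations (X : g -> Prop) (V : lmodType {poly k})
    (act : U -> V -> nat -> V) (v : V) : Prop :=
  forall a n, X a -> n != 1%N -> Lop act n a v = 0.

(* [(a _(lambda) w) = {a, w} + lambda a w]; the values at arbitrary elements of
   [H (x) P] and [U] are then determined by the identities of a conformal
   module and by the fact that [g] generates [U]. *)
Definition is_poisson_action (P : algType k) (e : g -> P) (pb : P -> P -> P)
    (act : U -> Htensor P -> nat -> Htensor P) : Prop :=
  forall a w n, act (iota a) (Hten w) n =
    match n with
    | 0 => Hten (pb (e a) w)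
    | 1 => Hten (e a * w)
    | _ => 0
    end.

(* [v] generates [V], and [V] is the universal module generated by one
   element subject to the relations above. *)
Definition defined_by_relations (X : g -> Prop) (V : lmodType {poly k})
    (act : U -> V -> nat -> V) (v : V) : Prop :=
  [/\ conf_module_generated act v,
      killed_by_relations X act v
    & forall (W : lmodType {poly k}) (actW : U -> W -> nat -> W) (w : W),
        is_conf_module actW -> killed_by_relations X actW w ->
        exists f : V -> W,
          [/\ is_conf_module_hom act actW f, f v = w
            & forall f' : V -> W, is_conf_module_hom act actW f' ->
                f' v = w -> f' =1 f]].

End Module.

(* Main.v *)
Require Import Defs.
From HB Require Import structures.
From mathcomp Require Import all_boot all_algebra.
From mathcomp Require Import boolp functions.

Set Implicit Arguments.
Unset Strict Implicit.
Unset Printing Implicit Defensive.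

Import GRing.Theory.
Local Open Scope ring_scope.

(** The operators [ad a - d L_a] ([L_a] is multiplication by [a]) define a
    homomorphism from [U] to the current conformal algebra of [End P], which
    acts on [H (x) P]; this is the required action.

    If [w] is killed by the relations, the locality and commutator identities
    of [U] give [L_n^a L_1^b v = L_1^b L_n^a v + L_(n+1)^[a,b] v].  Hence
    [L_n] vanishes for [n >= 2] on the words [L_1^a1 ... L_1^ar w], on which
    the [L_1^a] therefore commute and the [L_0^a] act by derivations.  The map
    [a1 ... ar |-> L_1^a1 ... L_1^ar w] is then well defined on the symmetric
    algebra of [g], and on [P] by the Poincare-Birkhoff-Witt theorem.

    That theorem is proved in characteristic zero without ordering a basis: a
    symmetric multilinear form in degree [n] is extended degree by degree to
    a form on all words satisfying [A(u x y v) - A(u y x v) = A(u [x,y] v)],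
    by averaging over the letter that is moved to the front of the word.  The
    forms with this property are a representation of [g], hence of [U(g)]. *)

(** * Endomorphism algebras *)

Section Endomorphisms.
Variables (k : fieldType) (V : lmodType k).

(** [nontrivial] is a parameter because an [algType] must satisfy [1 != 0]; with the witness in the
    type, the ring structure can be inferred. *)
Record endo (nontrivial : exists v : V, v <> 0) :=
  Endo { endo_fun :> V -> V; endo_linear : linear endo_fun }.

Variable nontrivial : exists v : V, v <> 0.
Notation E := (endo nontrivial).

Lemma endoP (f g : E) : f =1 g -> f = g.
Proof.
case: f g => [f lf] [g lg] /= /funext fg.
by case: _ / fg lg => lg; congr Endo; exact: Prop_irrelevance.
Qed.

HB.instance Definition _ := gen_eqMixin E.
HB.instance Definition _ := gen_choiceMixin E.

Lemma endoD (f : E) : {morph f : x y / x + y}.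
Proof. by move=> x y; have := endo_linear f 1 x y; rewrite !scale1r. Qed.

Lemma endo0 (f : E) : f 0 = 0.
Proof. by apply: (addrI (f 0)); rewrite -endoD !addr0. Qed.

Lemma endoZ (f : E) c x : f (c *: x) = c *: f x.
Proof. by have := endo_linear f c x 0; rewrite endo0 !addr0. Qed.

Fact endo_zero_linear : linear (fun _ : V => 0 : V).
Proof. by move=> c x y; rewrite scaler0 addr0. Qed.

Fact endo_add_linear (f g : E) : linear (fun x => f x + g x).
Proof. by move=> c x y; rewrite !endo_linear scalerDr addrACA. Qed.

Fact endo_opp_linear (f : E) : linear (fun x => - f x).
Proof. by move=> c x y; rewrite endo_linear scalerN opprD. Qed.

Fact endo_one_linear : linear (fun x : V => x).
Proof. by []. Qed.

Fact endo_mul_linear (f g : E) : linear (fun x => f (g x)).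
Proof. by move=> c x y; rewrite !endo_linear. Qed.

Fact endo_scale_linear d (f : E) : linear (fun x => d *: f x).
Proof. by move=> c x y; rewrite endo_linear scalerDr !scalerA mulrC. Qed.

Definition endo_zero : E := Endo nontrivial endo_zero_linear.
Definition endo_add (f g : E) : E := Endo nontrivial (endo_add_linear f g).
Definition endo_opp (f : E) : E := Endo nontrivial (endo_opp_linear f).
Definition endo_one : E := Endo nontrivial endo_one_linear.
Definition endo_mul (f g : E) : E := Endo nontrivial (endo_mul_linear f g).
Definition endo_scale d (f : E) : E := Endo nontrivial (endo_scale_linear d f).

Fact endo_addA : associative endo_add.
Proof. by move=> f g h; apply: endoP => x /=; rewrite addrA. Qed.

Fact endo_addC : commutative endo_add.
Proof. by move=> f g; apply: endoP => x /=; rewrite addrC. Qed.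

Fact endo_add0 : left_id endo_zero endo_add.
Proof. by move=> f; apply: endoP => x /=; rewrite add0r. Qed.

Fact endo_addN : left_inverse endo_zero endo_opp endo_add.
Proof. by move=> f; apply: endoP => x /=; rewrite addNr. Qed.

HB.instance Definition _ :=
  GRing.isZmodule.Build E endo_addA endo_addC endo_add0 endo_addN.

Fact endo_mulA : associative endo_mul.
Proof. by move=> f g h; apply: endoP. Qed.

Fact endo_mul1l : left_id endo_one endo_mul.
Proof. by move=> f; apply: endoP. Qed.

Fact endo_mul1r : right_id endo_one endo_mul.
Proof. by move=> f; apply: endoP. Qed.

Fact endo_mulDl : left_distributive endo_mul +%R.
Proof. by move=> f g h; apply: endoP. Qed.

Fact endo_mulDr : right_distributive endo_mul +%R.
Proof. by move=> f g h; apply: endoP => x /=; rewrite endoD. Qed.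

Fact endo_one_neq0 : endo_one != 0.
Proof.
case: nontrivial => v nz_v; apply/eqP => /(congr1 (fun f : E => f v)).
exact: nz_v.
Qed.

HB.instance Definition _ := GRing.Zmodule_isNzRing.Build E
  endo_mulA endo_mul1l endo_mul1r endo_mulDl endo_mulDr endo_one_neq0.

Fact endo_scaleA c d f : endo_scale c (endo_scale d f) = endo_scale (c * d) f.
Proof. by apply: endoP => x /=; rewrite scalerA. Qed.

Fact endo_scale1 : left_id 1 endo_scale.
Proof. by move=> f; apply: endoP => x /=; rewrite scale1r. Qed.

Fact endo_scaleDr : right_distributive endo_scale +%R.
Proof. by move=> c f g; apply: endoP => x /=; rewrite scalerDr. Qed.

Fact endo_scaleDl f : {morph endo_scale^~ f : c d / c + d}.
Proof. by move=> c d; apply: endoP => x /=; rewrite scalerDl. Qed.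

HB.instance Definition _ := GRing.Zmodule_isLmodule.Build k E
  endo_scaleA endo_scale1 endo_scaleDr endo_scaleDl.

Fact endo_scaleAl c (f g : E) : c *: (f * g) = c *: f * g.
Proof. by apply: endoP. Qed.

Fact endo_scaleAr c (f g : E) : c *: (f * g) = f * (c *: g).
Proof. by apply: endoP => x /=; rewrite endoZ. Qed.

HB.instance Definition _ := GRing.Lmodule_isLalgebra.Build k E endo_scaleAl.
HB.instance Definition _ := GRing.Lalgebra_isAlgebra.Build k E endo_scaleAr.

End Endomorphisms.

(** * The Poincare-Birkhoff-Witt theorem *)

Section SplitSum.
Variables (T : Type) (V : zmodType).

(* The sum of [F p x s] over the factorizations [w = p ++ x :: s]. *)
Definition split_sum (F : seq T -> T -> seq T -> V) (w : seq T) : V :=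
  (fix sum (F : seq T -> T -> seq T -> V) w :=
     if w is x :: s then F [::] x s + sum (fun p => F (x :: p)) s else 0) F w.

Implicit Types F G : seq T -> T -> seq T -> V.

Lemma split_sum_cons F x s :
  split_sum F (x :: s) = F [::] x s + split_sum (fun p => F (x :: p)) s.
Proof. by []. Qed.

Lemma split_sum_cat F u v :
  split_sum F (u ++ v) =
  split_sum (fun p x s => F p x (s ++ v)) u
  + split_sum (fun p => F (u ++ p)) v.
Proof.
elim: u F => [|x u IH] F; first by rewrite add0r.
by rewrite cat_cons !split_sum_cons IH addrA.
Qed.

Lemma eq_split_sum F G w :
  (forall p x s, w = p ++ x :: s -> F p x s = G p x s) ->
  split_sum F w = split_sum G w.
Proof.
elim: w F G => // x s IH F G FG; rewrite !split_sum_cons FG //.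
by congr (_ + _); apply: IH => p y t ws; apply: FG; rewrite ws.
Qed.

Lemma split_sumD F G w :
  split_sum (fun p x s => F p x s + G p x s) w = split_sum F w + split_sum G w.
Proof.
elim: w F G => [|x s IH] F G; first by rewrite addr0.
by rewrite !split_sum_cons IH addrACA.
Qed.

Lemma split_sumB F G w :
  split_sum (fun p x s => F p x s - G p x s) w = split_sum F w - split_sum G w.
Proof.
elim: w F G => [|x s IH] F G; first by rewrite subr0.
by rewrite !split_sum_cons IH opprD addrACA.
Qed.

Lemma split_sum_const (c : V) w : split_sum (fun _ _ _ => c) w = c *+ size w.
Proof. by elim: w => // x s IH; rewrite split_sum_cons IH mulrS. Qed.

End SplitSum.

Lemma split_sumZ (k : fieldType) (T : Type) (V : lmodType k) (c : k)
    (F : seq T -> T -> seq T -> V) w :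
  split_sum (fun p x s => c *: F p x s) w = c *: split_sum F w.
Proof.
elim: w F => [|x s IH] F; first by rewrite scaler0.
by rewrite !split_sum_cons IH scalerDr.
Qed.

(** * Straightening extensions of symmetric multilinear forms *)

Section Extension.
Variables (k : fieldType) (g : lmodType k) (br : g -> g -> g).
Hypothesis char0 : [pchar k] =i pred0.
Hypothesis br_lie : is_lie_bracket br.
Variable V : lmodType k.
Implicit Types (A B : seq g -> V) (u v w p s : seq g).

Definition multilinear_word A :=
  forall u v, linear (fun x => A (u ++ x :: v)).

(** Two forms occur because the extension is built degree by degree: each new form straightens to
    the previous one. *)
Definition straightens A B := forall u v x y,
  A (u ++ x :: y :: v) - A (u ++ y :: x :: v) = B (u ++ br x y :: v).

(* What [B] prescribes for [A (p ++ x :: s) - A (x :: p ++ s)]. *)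
Definition move_front B p x s :=
  split_sum (fun q y r => B (q ++ br y x :: r ++ s)) p.

(* The average over the letters [x] of the values obtained by moving [x] to the
   front and extending, by recursion, the form with first letter [x] fixed. *)
Fixpoint extend_rec (n : nat) A w : V :=
  if n is m.+1 then
    n%:R^-1 *: split_sum (fun p x s =>
      extend_rec m (fun u => A (x :: u)) (p ++ s) + move_front A p x s) w
  else 0.

Definition extend A w := extend_rec (size w) A w.

(** The letter [x] passes those of [p] from right to left; each transposition with a letter [y]
    leaves a value of [B] with [[y, x]] in place of the pair. *)
Lemma move_frontE A B p x s : straightens A B ->
  A (p ++ x :: s) = A (x :: p ++ s) + move_front B p x s.
Proof.
move=> AB; elim/last_ind: p s => [|p y IH] s /=; first by rewrite addr0.
rewrite -cats1 -!catA /=.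
have -> : A (p ++ y :: x :: s)
    = A (p ++ x :: y :: s) + B (p ++ br y x :: s) by rewrite -AB addrC subrK.
rewrite IH -addrA; congr (_ + _).
rewrite /move_front split_sum_cat split_sum_cons addr0 /= cats0.
by congr (_ + _); apply: eq_split_sum => q z r _; rewrite -catA.
Qed.

Lemma brC x y : br x y = - br y x.
Proof.
have [[br_l br_r] brxx _] := br_lie.
have D1 z a b : br z (a + b) = br z a + br z b.
  by have := br_l z 1 a b; rewrite !scale1r.
have D2 z a b : br (a + b) z = br a z + br b z.
  by have := br_r z 1 a b; rewrite !scale1r.
have := brxx (x + y); rewrite D1 !D2 !brxx add0r addr0 => /eqP.
by rewrite addrC addr_eq0 => /eqP.
Qed.

Lemma brN x y : br x (- y) = - br x y.
Proof.
have [[br_l _] _ _] := br_lie.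
have D a b : br x (a + b) = br x a + br x b.
  by have := br_l x 1 a b; rewrite !scale1r.
by apply/eqP; rewrite -addr_eq0 -D addNr; apply/eqP; apply: (addrI (br x 0));
  rewrite -D !addr0.
Qed.

(** Right bracketing with [z] is a derivation: this is the form that arises when a letter [z] is
    moved across an adjacent pair [x y]. *)
Lemma br_jacobi x y z : br (br x y) z = br (br x z) y + br x (br y z).
Proof.
have [_ _ jac] := br_lie; have /eqP := jac x y z.
rewrite addr_eq0 [br z (br x y)]brC opprK => /eqP <-; rewrite addrC.
by rewrite [br z x]brC brN -brC.
Qed.

Lemma br_linear_l z : linear (br^~ z).
Proof. by have [[_ br_r] _ _] := br_lie. Qed.

Lemma br_linear_r z : linear (br z).
Proof. by have [[br_l _] _ _] := br_lie. Qed.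

Lemma split_sum_linear (T : Type) c (F G H : seq T -> T -> seq T -> V)
    (w : seq T) :
  (forall (p : seq T) x (s : seq T), w = p ++ x :: s -> F p x s = c *: G p x s + H p x s) ->
  split_sum F w = c *: split_sum G w + split_sum H w.
Proof. by rewrite -split_sumZ -split_sumD; apply: eq_split_sum. Qed.

Section Multilinear.
Variable A : seq g -> V.
Hypothesis A_lin : multilinear_word A.

Lemma multilinear_cons x : multilinear_word (fun u => A (x :: u)).
Proof. by move=> u v; apply: (A_lin (x :: u)). Qed.

Lemma move_front_linear_letter p s : linear (fun z => move_front A p z s).
Proof.
move=> c x y; apply: split_sum_linear => q t r _.
by rewrite br_linear_r A_lin.
Qed.

Lemma move_front_linear_prefix u v x s :
  linear (fun z => move_front A (u ++ z :: v) x s).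
Proof.
move=> c y z; rewrite /move_front !split_sum_cat !split_sum_cons.
rewrite br_linear_l cats0 !A_lin.
rewrite (split_sum_linear (c := c)
  (G := fun q t r => A (q ++ br t x :: (r ++ y :: v) ++ s))
  (H := fun q t r => A (q ++ br t x :: (r ++ z :: v) ++ s))); last first.
  move=> q t r _; have := A_lin (q ++ br t x :: r) (v ++ s) c y z.
  by rewrite -!catA !cat_cons -?catA.
rewrite (split_sum_linear (c := c) (w := v)
  (G := fun q t r => A ((u ++ y :: q) ++ br t x :: r ++ s))
  (H := fun q t r => A ((u ++ z :: q) ++ br t x :: r ++ s))); last first.
  by move=> q t r _; rewrite -!catA !cat_cons A_lin.
by rewrite !scalerDr [X in _ + X = _]addrACA [LHS]addrACA.
Qed.

Lemma move_front_linear_suffix p x u v :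
  linear (fun z => move_front A p x (u ++ z :: v)).
Proof.
move=> c y z; apply: split_sum_linear => q t r _.
by have := A_lin (q ++ br t x :: r ++ u) v c y z; rewrite -!catA !cat_cons -?catA.
Qed.

End Multilinear.

(** Linearity in the form itself takes care, in [extend_rec_multilinear], of the summand in which
    the varied letter is the one that is moved to the front. *)
Lemma extend_rec_linear n c A B w :
  extend_rec n (fun u => c *: A u + B u) w
  = c *: extend_rec n A w + extend_rec n B w.
Proof.
elim: n A B w => [|n IH] A B w; first by rewrite scaler0 addr0.
rewrite [LHS]/= [X in c *: X]/= scalerA mulrC -scalerA -scalerDr; congr (_ *: _).
apply: split_sum_linear => p x s _; rewrite IH scalerDr addrACA; congr (_ + _).
exact: split_sum_linear.
Qed.

Lemma extend_rec_multilinear n A :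
  multilinear_word A -> multilinear_word (extend_rec n A).
Proof.
elim: n A => [|n IH] A A_lin u v c y z; first by rewrite scaler0 addr0.
rewrite [LHS]/= [X in c *: X]/= scalerA mulrC -scalerA -scalerDr; congr (_ *: _).
(* Three kinds of summands: the varied letter stands to the right of the moved one, is the moved
   one, or stands to its left. *)
rewrite !split_sum_cat !split_sum_cons !cats0.
set S1 := split_sum _ u; set S2 := split_sum _ v.
rewrite (_ : (fun _ => _) = fun w => c *: A (y :: w) + A (z :: w)); last first.
  by apply/funext => w; apply: (A_lin [::] w).
rewrite extend_rec_linear move_front_linear_letter // {}/S1 {}/S2.
rewrite (split_sum_linear (c := c)
  (G := fun p x s => extend_rec n (fun w => A (x :: w)) (p ++ s ++ y :: v)
     + move_front A p x (s ++ y :: v))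
  (H := fun p x s => extend_rec n (fun w => A (x :: w)) (p ++ s ++ z :: v)
     + move_front A p x (s ++ z :: v))); last first.
  move=> p x s _; rewrite !catA IH; last exact: multilinear_cons.
  by rewrite move_front_linear_suffix // scalerDr addrACA.
rewrite (split_sum_linear (c := c) (w := v)
  (G := fun p x s => extend_rec n (fun w => A (x :: w)) ((u ++ y :: p) ++ s)
     + move_front A (u ++ y :: p) x s)
  (H := fun p x s => extend_rec n (fun w => A (x :: w)) ((u ++ z :: p) ++ s)
     + move_front A (u ++ z :: p) x s)); last first.
  move=> p x s _; rewrite -!catA !cat_cons IH; last exact: multilinear_cons.
  by rewrite move_front_linear_prefix // scalerDr addrACA.
rewrite !scalerDr [X in _ + (X + _) = _]addrACA [X in _ + X = _]addrACA.
by rewrite [LHS]addrACA.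
Qed.

Lemma multilinearN A u v x : multilinear_word A ->
  A (u ++ - x :: v) = - A (u ++ x :: v).
Proof.
move=> A_lin.
have D y z : A (u ++ (y + z) :: v) = A (u ++ y :: v) + A (u ++ z :: v).
  by have := A_lin u v 1 y z; rewrite !scale1r.
have A0 : A (u ++ 0 :: v) = 0.
  by apply: (addrI (A (u ++ 0 :: v))); rewrite -D !addr0.
by apply/eqP; rewrite -addr_eq0 -D addNr A0.
Qed.

Lemma straightens_cons A B x :
  straightens A B -> straightens (fun u => A (x :: u)) (fun u => B (x :: u)).
Proof. by move=> AB u v y z; apply: (AB (x :: u)). Qed.

Lemma move_front_cat B u v x s :
  move_front B (u ++ v) x s
  = move_front B u x (v ++ s) + move_front (fun w => B (u ++ w)) v x s.
Proof.
rewrite /move_front split_sum_cat; congr (_ + _).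
  by apply: eq_split_sum => q y r _; rewrite -catA.
by apply: eq_split_sum => q y r _; rewrite -catA.
Qed.

Lemma move_front_cons B y v x s :
  move_front B (y :: v) x s
  = B (br y x :: v ++ s) + move_front (fun w => B (y :: w)) v x s.
Proof. by []. Qed.

(** Both averages are compared letter by letter, after multiplication by the length of the word.
    Each letter other than [x] and [y] contributes [T], the required value, by induction applied to
    the form with this first letter fixed; [x] and [y] together contribute [2 T]. The sum is [T]
    times the length, which is invertible in characteristic zero. *)
Lemma extend_rec_straightens n A B u v x y :
  multilinear_word A -> multilinear_word B -> straightens A B ->
  size (u ++ x :: y :: v) = n ->
  extend_rec n A (u ++ x :: y :: v) - extend_rec n A (u ++ y :: x :: v)
  = A (u ++ br x y :: v).
Proof.
elim: n A B u v x y => [|n IH] A B u v x y A_lin B_lin AB; first by rewrite size_cat addnS.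
move=> sz; have {}sz : (size u + size v).+1 = n.
  by move: sz; rewrite size_cat /= !addnS => - [].
set T := A _.
have nz : n.+1%:R != 0 :> k by rewrite ((pcharf0P k).1 char0).
rewrite [extend_rec _ _ (u ++ x :: _)]/= [extend_rec _ _ (u ++ y :: _)]/=.
rewrite -scalerBr; apply: (scalerI nz); rewrite scalerA divff // scale1r.
rewrite !split_sum_cat !split_sum_cons.
(* A letter [z] before the pair: induction gives [T] with [z] moved to the front, and the difference
   of the corrections is what [move_frontE] needs to put [z] back. *)
have pref p z s : u = p ++ z :: s ->
  extend_rec n (fun w => A (z :: w)) (p ++ s ++ x :: y :: v)
    + move_front A p z (s ++ x :: y :: v)
  - (extend_rec n (fun w => A (z :: w)) (p ++ s ++ y :: x :: v)
    + move_front A p z (s ++ y :: x :: v)) = T.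
  move=> du; rewrite opprD addrACA !catA.
  rewrite (IH _ (fun w => B (z :: w))); first last.
  - by rewrite !size_cat /= -sz du size_cat /= !(addnS, addSn).
  - exact: straightens_cons.
  - exact: multilinear_cons.
  - exact: multilinear_cons.
  rewrite /T du -!catA cat_cons (move_frontE _ _ _ AB) -?catA; congr (_ + _).
  rewrite -split_sumB; apply: eq_split_sum => q t r _.
  have := AB (q ++ br t z :: r ++ s) v x y.
  by rewrite -!catA !cat_cons -?catA.
(* A letter [z] after the pair also crosses [x] and [y]. The four terms with [[x, z]] or [[y, z]]
   straighten to values of [B] at [[[x, z], y]] and [[x, [y, z]]], and the Jacobi identity adds
   these up to the value at [[[x, y], z]]. *)
have suff_ p z s : v = p ++ z :: s ->
  extend_rec n (fun w => A (z :: w)) ((u ++ x :: y :: p) ++ s)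
    + move_front A (u ++ x :: y :: p) z s
  - (extend_rec n (fun w => A (z :: w)) ((u ++ y :: x :: p) ++ s)
    + move_front A (u ++ y :: x :: p) z s) = T.
  move=> dv; rewrite opprD addrACA -!catA !cat_cons.
  rewrite (IH _ (fun w => B (z :: w))); first last.
  - by rewrite !size_cat /= !size_cat -sz dv size_cat /= !(addnS, addSn) addnA.
  - exact: straightens_cons.
  - exact: multilinear_cons.
  - exact: multilinear_cons.
  rewrite /T dv.
  have -> : u ++ br x y :: p ++ z :: s = (u ++ br x y :: p) ++ z :: s.
    by rewrite -catA.
  rewrite (move_frontE _ _ _ AB) -?catA; congr (_ + _).
  rewrite !move_front_cat !move_front_cons /=.
  have move_diff (F : seq g -> g -> seq g -> V) G H w :
      (forall q t r, F q t r - G q t r = H q t r) ->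
      split_sum F w = split_sum G w + split_sum H w.
    move=> FG; rewrite -split_sumD; apply: eq_split_sum => q t r _.
    by rewrite -FG addrC subrK.
  rewrite [X in X + _ - _](move_diff _
    (fun q t r => A (q ++ br t z :: r ++ y :: x :: p ++ s))
    (fun q t r => B (q ++ br t z :: r ++ br x y :: p ++ s))); last first.
    move=> q t r; have := AB (q ++ br t z :: r) (p ++ s) x y.
    by rewrite -!catA.
  rewrite [X in _ + (_ + (_ + X)) - _](move_diff _
    (fun q t r => A (u ++ y :: x :: q ++ br t z :: r ++ s))
    (fun q t r => B (u ++ br x y :: q ++ br t z :: r ++ s))); last first.
    by move=> q t r; rewrite AB.
  have -> : B (u ++ br (br x y) z :: p ++ s)
      = B (u ++ br (br x z) y :: p ++ s) + B (u ++ br x (br y z) :: p ++ s).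
    by have := B_lin u (p ++ s) 1 (br (br x z) y) (br x (br y z));
      rewrite !scale1r -br_jacobi.
  rewrite -!AB -{1}[A (u ++ br x z :: y :: _)](subrK (A (u ++ y :: br x z :: p ++ s))).
  rewrite -{1}[A (u ++ x :: br y z :: _)](subrK (A (u ++ br y z :: x :: p ++ s))).
  have ac (n1 h1 n2 h2 c1 c2 b1 b2 : V) :
      (n1 + h1) + ((c1 + b2) + ((c2 + b1) + (n2 + h2)))
      - (n1 + (b1 + (b2 + n2))) = h1 + ((c1 + c2) + h2).
    apply/eqP; rewrite subr_eq; apply/eqP.
    by rewrite (AC (2*(2*(2*2))) ((2*((3*5)*8))*(1*(6*(4*7))))).
  exact: ac.
rewrite !cats0 -!(catA u [:: _]) !cat1s !move_front_cat !move_front_cons.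
rewrite [split_sum _ u](eq_split_sum (G := fun p z s =>
  T + (extend_rec n (fun w => A (z :: w)) (p ++ s ++ y :: x :: v)
    + move_front A p z (s ++ y :: x :: v)))); last first.
  by move=> p z s /pref <-; rewrite subrK.
rewrite [X in _ + (_ + (_ + X)) - _](eq_split_sum (G := fun p z s =>
  T + (extend_rec n (fun w => A (z :: w)) ((u ++ y :: x :: p) ++ s)
    + move_front A (u ++ y :: x :: p) z s))); last first.
  by move=> p z s /suff_ <-; rewrite subrK.
rewrite !split_sumD !split_sum_const /= !addr0.
(* Moving [y] over [x] in the first word costs [T], moving [x] over [y] in the second costs [- T];
   all other terms for these two letters agree, so that their difference is [2 T]. *)
rewrite [br y x]brC multilinearN // -/T.
have ac (tu S a m b my t tv R : V) :
    (tu + S) + ((a + m) + ((b + (my + t)) + (tv + R)))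
    - (S + ((b + my) + ((a + (m - t)) + R))) = tu + tv + t + t.
  rewrite -{1}[m](subrK t); set m' := m - t.
  apply/eqP; rewrite subr_eq; apply/eqP.
  by rewrite (AC (2*((1*2)*((1*2)*2))) ((1*9*5*8)*(2*((6*7)*((3*4)*10))))).
by rewrite ac scaler_nat -!mulrnDr -!mulrSr -sz.
Qed.

Lemma extend_multilinear A : multilinear_word A -> multilinear_word (extend A).
Proof.
move=> A_lin u v c y z; rewrite /extend !size_cat /=.
exact: extend_rec_multilinear.
Qed.

Lemma extend_straightens A B : multilinear_word A -> multilinear_word B ->
  straightens A B -> straightens (extend A) A.
Proof.
move=> A_lin B_lin AB u v x y; rewrite /extend.
rewrite (_ : size (u ++ y :: x :: v) = size (u ++ x :: y :: v)).
  exact: (extend_rec_straightens (B := B)).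
by rewrite !size_cat.
Qed.

(* Words of length [n + i] are evaluated by the [i]-th iterate because [extend A]
   straightens to [A] one degree lower, and a symmetric [A] straightens to 0. *)
Definition straight_form (n : nat) A w : V :=
  if (n <= size w)%N then iter (size w - n) extend A w else 0.

Lemma straight_formP n A : multilinear_word A ->
    (forall u v x y, A (u ++ x :: y :: v) = A (u ++ y :: x :: v)) ->
  [/\ multilinear_word (straight_form n A),
      straightens (straight_form n A) (straight_form n A),
      forall w, (size w < n)%N -> straight_form n A w = 0
    & forall w, size w = n -> straight_form n A w = A w].
Proof.
move=> A_lin A_sym.
have iter_lin i : multilinear_word (iter i extend A).
  by elim: i => // i IH; apply: extend_multilinear.
have zero_lin : multilinear_word (fun _ => 0).
  by move=> u v c x y; rewrite scaler0 addr0.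
have iter_str i : straightens (iter i.+1 extend A) (iter i extend A).
  elim: i => [|i IH]; last exact: extend_straightens (iter_lin _) IH.
  apply: (extend_straightens (B := fun _ => 0)) => // u v x y.
  by rewrite A_sym subrr.
split=> [u v c x y|u v x y|w|w].
- rewrite /straight_form !size_cat /=; case: ifP => _; first exact: iter_lin.
  exact: zero_lin.
- rewrite /straight_form !size_cat /= !addnS.
  (* The word with the bracket is one letter shorter. Above degree [n] consecutive iterates are
     compared, below it everything is 0, and in degree [n] the shorter word has value 0 while [A] is
     symmetric. *)
  case: (ltngtP n (size u + size v).+2) => [lt_n|lt_n|->].
  + by rewrite -ltnS lt_n subSn // iter_str.
  + by rewrite subr0 leqNgt (ltn_trans _ lt_n).
  + by rewrite ltnn subnn /= A_sym subrr.
- by rewrite /straight_form ltnNge; case: ifP.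
- by rewrite /straight_form => ->; rewrite leqnn subnn.
Qed.

End Extension.

(** * Straightening forms as functionals on the universal enveloping algebra *)

Section EnvelopeFunctionals.
Variables (k : fieldType) (g : lmodType k) (br : g -> g -> g).
Variables (V : lmodType k).

Definition straight_forms : {pred (seq g -> V)} :=
  fun A => `[< multilinear_word A /\ straightens br A A >].

Fact straight_forms_submod : submod_closed straight_forms.
Proof.
split=> [|c A B /asboolP [A_lin A_str] /asboolP [B_lin B_str]]; apply/asboolP.
  have zeroE w : (0 : seq g -> V) w = 0 by [].
  by split=> [u v c x y|u v x y]; rewrite !zeroE ?scaler0 ?addr0 ?subr0.
have combE w : (c *: A + B) w = c *: A w + B w by [].
split=> [u v d x y|u v x y]; rewrite !combE.
  rewrite A_lin B_lin !scalerDr addrACA !scalerA; congr (_ + _ + _).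
  by rewrite mulrC.
by rewrite opprD addrACA -scalerBr A_str B_str.
Qed.

HB.instance Definition _ :=
  GRing.isSubmodClosed.Build k (seq g -> V) straight_forms straight_forms_submod.

Record straight_form_space :=
  StraightForm { form_val :> seq g -> V; form_valP : form_val \in straight_forms }.

HB.instance Definition _ := [isSub for form_val].
HB.instance Definition _ := [Choice of straight_form_space by <:].
HB.instance Definition _ :=
  [SubChoice_isSubLmodule of straight_form_space by <:].

Notation M := straight_form_space.

Lemma form_straight (A : M) : multilinear_word A /\ straightens br A A.
Proof. exact/asboolP/form_valP. Qed.

Fact append_letter_subproof x (A : M) :
  (fun u => A (rcons u x)) \in straight_forms.
Proof.
have [A_lin A_str] := form_straight A; apply/asboolP.
by split=> [u v c y z|u v y z]; rewrite !rcons_cat /= ?A_lin ?A_str.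
Qed.

(** Appending on the right makes a composite of these operators read its letters in order.
    Straightening then says that their commutators are the operators of the brackets, so that the
    forms are a representation of [g]. *)
Definition append_letter x (A : M) : M :=
  StraightForm (append_letter_subproof x A).

Fact append_letter_linear x : linear (append_letter x).
Proof. by move=> c A B; apply: val_inj. Qed.

Variables (Ug : algType k) (j : g -> Ug).
Hypothesis Ug_env : is_lie_envelope br j.

(** The functional lets an element of [Ug] act on the form [A] and evaluates the result at the empty
    word. *)
Lemma envelope_functional (A : seq g -> V) :
    multilinear_word A -> straightens br A A ->
  exists Phi : Ug -> V, linear Phi /\ forall s, Phi (\prod_(a <- s) j a) = A s.
Proof.
move=> A_lin A_str.
(* The zero form is treated apart: otherwise [A] itself shows that the space of forms is non-zero,
   as its endomorphism algebra requires. *)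
have [A0|nz_A] := pselect (forall s, A s = 0).
  by exists (fun _ => 0); split=> [c x y|s]; rewrite ?A0 // scaler0 addr0.
have A_in : A \in straight_forms by apply/asboolP.
pose A' := StraightForm A_in.
have ntM : exists B : M, B <> 0.
  by exists A' => /(congr1 val) A0; apply: nz_A => s; rewrite -[A]/(val A') A0.
pose rho x : endo ntM := Endo ntM (append_letter_linear x).
have rho_rep : is_lie_rep br rho.
  split=> [c x y|x y]; apply: endoP => B; apply: val_inj; apply/funext => u /=;
    have [B_lin B_str] := form_straight B.
    by have := B_lin u [::] c x y; rewrite !cats1.
  by have := B_str u [::] x y; rewrite -!cat_rcons !cats0 => <-.
have [f [[f_lin [f1 fM]] fj _]] := Ug_env.2 _ _ rho_rep.
exists (fun x => f x A' [::]); split=> [c x y|s].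
  by rewrite f_lin.
(* The prefix [u] is generalized because the induction shifts the letters of [s] into it one by
   one. *)
suff: forall u, f (\prod_(a <- s) j a) A' u = A (u ++ s) by move/(_ [::]).
elim: s => [|a s IH] u; first by rewrite big_nil f1 cats0.
by rewrite big_cons fM fj /= IH cat_rcons.
Qed.

End EnvelopeFunctionals.

Section LinearFunctions.
Variables (R : nzRingType) (V W : lmodType R) (f : V -> W).
Hypothesis f_lin : linear f.

Let f_bundled : {linear V -> W} := HB.pack f (GRing.isLinear.Build R V W _ f f_lin).

Lemma linear_function0 : f 0 = 0.
Proof. exact: linear0 f_bundled. Qed.

Lemma linear_functionD x y : f (x + y) = f x + f y.
Proof. exact: linearD f_bundled x y. Qed.

Lemma linear_functionZ c x : f (c *: x) = c *: f x.
Proof. exact: (linearZ_LR f_bundled). Qed.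

Lemma linear_function_sum (I : Type) (r : seq I) (Q : pred I) (F : I -> V) :
  f (\sum_(i <- r | Q i) F i) = \sum_(i <- r | Q i) f (F i).
Proof. exact: (linear_sum f_bundled). Qed.

End LinearFunctions.

(** * The associated graded algebra of the enveloping algebra *)

Section AssociatedGraded.
Variables (k : fieldType) (g : lmodType k) (br : g -> g -> g).
Variables (Ug : algType k) (j : g -> Ug).
Hypothesis Ug_env : is_lie_envelope br j.
Variables (P : algType k) (sigma : nat -> Ug -> P).
Notation F := (canonical_filtration j).
Hypothesis P_gr : is_assoc_graded F sigma.
Notation e a := (sigma 1 (j a)).

Lemma filtration_monomial n s : (size s <= n)%N -> F n (\prod_(a <- s) j a).
Proof.
move=> le_sn; exists [:: (1, s)]; rewrite /= le_sn; split=> //.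
by rewrite big_seq1 scale1r.
Qed.

Lemma filtration_linear n c x y : F n x -> F n y -> F n (c *: x + y).
Proof.
move=> [s [s_n ->]] [t [t_n ->]]; exists ([seq (c * z.1, z.2) | z <- s] ++ t).
split; first by rewrite all_cat t_n andbT all_map.
rewrite big_cat big_map scaler_sumr; congr (_ + _).
by apply: eq_bigr => z _; rewrite scalerA.
Qed.

Lemma filtration0 n : F n 0.
Proof. by exists [::]; rewrite big_nil. Qed.

Lemma filtration_le m n x : (m <= n)%N -> F m x -> F n x.
Proof.
move=> le_mn [s [s_m ->]]; exists s; split=> //.
by apply: sub_all s_m => z /leq_trans; apply.
Qed.

Lemma filtration_letter a : F 1 (j a).
Proof. by have := filtration_monomial (leqnn (size [:: a])); rewrite big_seq1. Qed.

Lemma sigma0 n : sigma n 0 = 0.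
Proof.
have [sl _ _ _ _] := P_gr.
have := sl n (-1) 0 0 (filtration0 n) (filtration0 n).
by rewrite scaler0 add0r scaleN1r addNr.
Qed.

Lemma sigma_lower m n x : (m < n)%N -> F m x -> sigma n x = 0.
Proof.
have [_ sker _ _ _] := P_gr; case: n => // n le_mn Fx.
have Fnx : F n x by apply: filtration_le Fx.
by apply/(sker n.+1 x (filtration_le (leqnSn n) Fnx)).
Qed.

Lemma sigma_monomial s :
  sigma (size s) (\prod_(a <- s) j a) = \prod_(a <- s) e a.
Proof.
have [_ _ [s1 sM] _ _] := P_gr.
elim: s => [|a s IH]; first by rewrite !big_nil.
rewrite !big_cons -IH -sM //; last exact: filtration_monomial.
exact: filtration_letter.
Qed.

(** A representative in [F n] is a combination of words of length at most [n], and [sigma n] kills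
    the shorter ones; so the products of letters span [P]. *)
Lemma graded_ind (S : P -> Prop) :
    (forall s, S (\prod_(a <- s) e a)) ->
    (forall c x y, S x -> S y -> S (c *: x + y)) ->
  forall x, S x.
Proof.
move=> S_mon SL x; have [sl _ _ sgen _] := P_gr.
have S0 : S 0.
  by have := SL (-1) _ _ (S_mon [::]) (S_mon [::]); rewrite scaleN1r addNr.
have {sgen} [N [y [Fy ->]]] := sgen x.
elim/big_rec: _ => // n z _ Sz; rewrite -[sigma _ _]scale1r; apply: (SL) => {z Sz}//.
have [s [s_n ->]] := Fy n; elim: s s_n => [_|[c t] s IH /andP [t_n s_n]].
  by rewrite big_nil sigma0.
rewrite big_cons sl; [|exact: filtration_monomial|by exists s].
apply: SL (IH s_n); move: t_n; rewrite leq_eqVlt => /orP [/eqP <-|lt_n].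
  by rewrite sigma_monomial.
by rewrite (sigma_lower lt_n) //; apply: filtration_monomial.
Qed.

(** The commutator of two letters is a bracket, which lies in [F 1] and is killed by [sigma 2]. *)
Lemma graded_letterC a b : e a * e b = e b * e a.
Proof.
have [sl _ [_ sM] _ _] := P_gr; have [[_ jbr] _] := Ug_env.
have FM x y : F 2 (j x * j y).
  have := @filtration_monomial 2 [:: x; y] isT.
  by rewrite big_cons big_seq1.
rewrite -!(sM 1 1)%N; try exact: filtration_letter.
apply/eqP; rewrite -subr_eq0 -scaleN1r addrC -sl //.
by rewrite scaleN1r addrC -jbr (sigma_lower (m := 1)) //; apply: filtration_letter.
Qed.

Hypothesis char0 : [pchar k] =i pred0.
Hypothesis br_lie : is_lie_bracket br.

(* The Poincare-Birkhoff-Witt theorem: [P] has the universal property of the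
   symmetric algebra with respect to linear maps. *)
Lemma graded_functional (V : lmodType k) (A : seq g -> V) :
    multilinear_word A ->
    (forall u v x y, A (u ++ x :: y :: v) = A (u ++ y :: x :: v)) ->
  exists f : P -> V, linear f /\ forall s, f (\prod_(a <- s) e a) = A s.
Proof.
move=> A_lin A_sym; have [sl sker _ sgen sindep] := P_gr.
(* The [n]-th form agrees with [A] in length [n] and vanishes on shorter words, so its functional
   [Phi n] on [F n] vanishes on [F m] for [m < n]. *)
have pbw n := straight_formP char0 br_lie n A_lin A_sym.
have /choice [Phi PhiP] n : exists Phi : Ug -> V, linear Phi
    /\ forall s, Phi (\prod_(a <- s) j a) = straight_form br n A s.
  by have [B_lin B_str _ _] := pbw n; apply: (envelope_functional Ug_env).
have Phi_lin n := (PhiP n).1; have Phi_mon n := (PhiP n).2.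
have Phi0 n : Phi n 0 = 0 by apply: linear_function0.
have Phi_low m n x : (m < n)%N -> F m x -> Phi n x = 0.
  move=> lt_mn [s [s_m ->]]; rewrite linear_function_sum // big_seq big1 // => z zs.
  have [_ _ low _] := pbw n; rewrite linear_functionZ // Phi_mon low ?scaler0 //.
  exact: leq_ltn_trans (allP s_m _ zs) lt_mn.
(* The map is obtained from its graph: an element of [P] has many homogeneous representatives, and
   the value has to be shown independent of them. *)
pose represents p v := exists (N : nat) (x : nat -> Ug), [/\ forall n, F n (x n),
  p = \sum_(n < N) sigma n (x n) & v = \sum_(n < N) Phi n (x n)].
have pad (W : zmodType) (h : nat -> Ug -> W) (x : nat -> Ug) N M :
    (N <= M)%N -> (forall n, h n 0 = 0) ->
    \sum_(n < N) h n (x n) = \sum_(n < M) h n (if (n < N)%N then x n else 0).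
  move=> le_NM h0; rewrite (big_ord_widen M (fun n => h n (x n)) le_NM).
  by rewrite big_mkcond; apply: eq_bigr => n _; case: ifP.
have rep_pad N x M : (N <= M)%N -> (forall n, F n (x n)) -> exists y,
    [/\ forall n, F n (y n),
        \sum_(n < N) sigma n (x n) = \sum_(n < M) sigma n (y n)
      & \sum_(n < N) Phi n (x n) = \sum_(n < M) Phi n (y n)].
  move=> le_NM Fx; exists (fun n => if (n < N)%N then x n else 0); split.
  - by move=> n; case: ifP => // _; apply: filtration0.
  - exact: pad _ sigma _ _ _ le_NM sigma0.
  - exact: pad _ Phi _ _ _ le_NM Phi0.
have rep_lin c p1 v1 p2 v2 v3 : represents p1 v1 -> represents p2 v2 ->
    represents (c *: p1 + p2) v3 -> v3 = c *: v1 + v2.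
  move=> [N1 [x1 [F1 -> ->]]] [N2 [x2 [F2 -> ->]]] [N3 [x3 [F3 + ->]]].
  pose M := (N1 + N2 + N3)%N.
  have [|{F1}y1 [F1 -> ->]] := rep_pad N1 x1 M _ F1.
    by rewrite /M -addnA leq_addr.
  have [|{F2}y2 [F2 -> ->]] := rep_pad N2 x2 M _ F2.
    by rewrite /M addnAC leq_addl.
  have [|{F3}y3 [F3 -> ->] eq_s] := rep_pad N3 x3 M _ F3.
    by rewrite /M leq_addl.
  (* The images [sigma n (y n)] sum to zero, so each one vanishes by directness. Then [y n] lies one
     step lower in the filtration, where [Phi n] is zero. *)
  pose y n := (-1) *: y3 n + (c *: y1 n + y2 n).
  have Fy n : F n (y n) by do 2 apply: filtration_linear => //.
  have sum_h (W : lmodType k) (h : nat -> Ug -> W) :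
      (forall n d x x', F n x -> F n x' -> h n (d *: x + x') = d *: h n x + h n x') ->
      \sum_(n < M) h n (y n) = - (\sum_(n < M) h n (y3 n))
        + (c *: \sum_(n < M) h n (y1 n) + \sum_(n < M) h n (y2 n)).
    move=> h_lin; rewrite scaler_sumr -!big_split -sumrN -big_split /=.
    apply: eq_bigr => n _; rewrite h_lin ?scaleN1r ?h_lin //.
    exact: filtration_linear.
  apply/eqP; rewrite eq_sym -subr_eq0 addrC -sum_h; last by move=> *; apply: Phi_lin.
  rewrite big1 // => n _.
  have: sigma n (y n) = 0.
    by apply: (sindep M y) => //; rewrite sum_h // eq_s addNr.
  move/(sker _ _ (Fy n)); case: (nat_of_ord n) => [->|m Fm] //.
  exact: Phi_low (ltnSn m) Fm.
have rep_uniq p v v' : represents p v -> represents p v' -> v = v'.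
  move=> pv pv'; rewrite (rep_lin 0 p v p v' v) ?scale0r ?add0r //.
have /choice [f fP] p : exists v, represents p v.
  by have [N [x [Fx ->]]] := sgen p; exists (\sum_(n < N) Phi n (x n)), N, x.
exists f; split=> [c p q|s]; first exact: (rep_lin c p _ q).
(* A product of letters is represented by the sequence concentrated in degree [size s]. *)
apply: rep_uniq (fP _) _; exists (size s).+1.
exists (fun n => if n == size s then \prod_(a <- s) j a else 0); split.
- by move=> n; case: eqP => [->|_]; [apply: filtration_monomial|apply: filtration0].
- rewrite big_ord_recr /= eqxx sigma_monomial [X in X + _]big1 ?add0r // => i _.
  by rewrite ltn_eqF // sigma0.
- rewrite big_ord_recr /= eqxx Phi_mon [X in X + _]big1 ?add0r => [|i _].
    by have [_ _ _ ->] := pbw (size s).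
  by rewrite ltn_eqF.
Qed.

End AssociatedGraded.

(** * Sesquilinear actions and conformal associativity *)

Section AdditiveFunctions.
Variables (V W : zmodType) (f : V -> W).
Hypothesis f_add : {morph f : x y / x + y}.

Fact zmod_morphism_of_add : zmod_morphism f.
Proof.
have f0 : f 0 = 0 by apply: (addrI (f 0)); rewrite -f_add !addr0.
have fN x : f (- x) = - f x by apply/eqP; rewrite -addr_eq0 -f_add addNr f0.
by move=> x y; rewrite f_add fN.
Qed.

Let f_bundled : {additive V -> W} :=
  HB.pack f (GRing.isZmodMorphism.Build V W f zmod_morphism_of_add).

Lemma additive_function0 : f 0 = 0.
Proof. exact: raddf0 f_bundled. Qed.

Lemma additive_functionN x : f (- x) = - f x.
Proof. exact: raddfN f_bundled x. Qed.

Lemma additive_functionMn x n : f (x *+ n) = f x *+ n.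
Proof. exact: raddfMn f_bundled n x. Qed.

End AdditiveFunctions.

Section Sesquilinear.
Variables (k : fieldType) (V W : lmodType {poly k}).
Variable act : V -> W -> nat -> W.
Hypothesis act_sesq : is_sesquilinear act.

Lemma sesqDl v n : {morph (fun a => act a v n) : a b / a + b}.
Proof.
by move=> a b; have [_ L _ _ _] := act_sesq; have := L 1 a b v n; rewrite polyC1 !scale1r.
Qed.

Lemma sesqDr a n : {morph (fun v => act a v n) : v w / v + w}.
Proof.
by move=> v w; have [_ _ L _ _] := act_sesq; have := L 1 a v w n; rewrite polyC1 !scale1r.
Qed.

Lemma sesq0l v n : act 0 v n = 0.
Proof. exact: additive_function0 (sesqDl v n). Qed.

Lemma sesq0r a n : act a 0 n = 0.
Proof. exact: additive_function0 (sesqDr a n). Qed.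

Lemma sesqNl a v n : act (- a) v n = - act a v n.
Proof. exact: additive_functionN (sesqDl v n) a. Qed.

Lemma sesqNr a v n : act a (- v) n = - act a v n.
Proof. exact: additive_functionN (sesqDr a n) v. Qed.

Lemma sesqCl c a v n : act (c%:P *: a) v n = c%:P *: act a v n.
Proof.
have [_ L _ _ _] := act_sesq; have := L c a 0 v n.
by rewrite sesq0l !addr0.
Qed.

Lemma sesqCr c a v n : act a (c%:P *: v) n = c%:P *: act a v n.
Proof.
have [_ _ L _ _] := act_sesq; have := L c a v 0 n.
by rewrite sesq0r !addr0.
Qed.

Lemma sesqXl a v n : act ('X *: a) v n = - lambda_mul (act a v) n.
Proof. by have [_ _ _ L _] := act_sesq. Qed.

Lemma sesqXr a v n : act a ('X *: v) n = 'X *: act a v n + lambda_mul (act a v) n.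
Proof. by have [_ _ _ _ L] := act_sesq. Qed.

End Sesquilinear.

Section ConfAssoc.
Variables (k : fieldType) (V W : lmodType {poly k}).
Variables (prod : V -> V -> nat -> V) (act : V -> W -> nat -> W).
Hypotheses (prod_sesq : is_sesquilinear prod) (act_sesq : is_sesquilinear act).

(** Associativity of a single triple, to be propagated from constants along sums and multiplication
    by [d] in each argument. *)
Definition assoc_at a b v := forall m n, act a (act b v n) m =
  \sum_(i < m.+1) act (prod a b i) v (m - i + n)%N *+ 'C(m - i + n, n).

Let actDl v n := sesqDl act_sesq v n.
Let actDr a n := sesqDr act_sesq a n.

Lemma assoc_atDl a1 a2 b v :
  assoc_at a1 b v -> assoc_at a2 b v -> assoc_at (a1 + a2) b v.
Proof.
move=> H1 H2 m n; rewrite actDl H1 H2 -big_split; apply: eq_bigr => i _ /=.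
by rewrite (sesqDl prod_sesq) actDl mulrnDl.
Qed.

Lemma assoc_atDm a b1 b2 v :
  assoc_at a b1 v -> assoc_at a b2 v -> assoc_at a (b1 + b2) v.
Proof.
move=> H1 H2 m n; rewrite actDl actDr H1 H2 -big_split; apply: eq_bigr => i _ /=.
by rewrite (sesqDr prod_sesq) actDl mulrnDl.
Qed.

Lemma assoc_atDr a b v1 v2 :
  assoc_at a b v1 -> assoc_at a b v2 -> assoc_at a b (v1 + v2).
Proof.
move=> H1 H2 m n; rewrite !actDr H1 H2 -big_split; apply: eq_bigr => i _ /=.
by rewrite actDr mulrnDl.
Qed.

(** Both sides acquire the factor [- lambda]. *)
Lemma assoc_atXl a b v : assoc_at a b v -> assoc_at ('X *: a) b v.
Proof.
move=> H m n; rewrite (sesqXl act_sesq) big_ord_recl /= (sesqXl prod_sesq) /=.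
rewrite oppr0 (sesq0l act_sesq) mul0rn add0r.
case: m => [|m]; first by rewrite big_ord0 oppr0.
rewrite /= H -sumrN; apply: eq_bigr => i _.
by rewrite (sesqXl prod_sesq) /= (sesqNl act_sesq) mulNrn subSS.
Qed.

(** The left side acquires the factor [- mu]. On the right [d + lambda] appears inside, and its [d]
    turns into [- (lambda + mu)], which leaves [- mu] as well; in coefficients this cancellation is
    Pascal's rule. *)
Lemma assoc_atXm a b v : assoc_at a b v -> assoc_at a ('X *: b) v.
Proof.
move=> H m n; rewrite (sesqXl act_sesq) (sesqNr act_sesq).
rewrite (eq_bigr (fun i : 'I_m.+1 =>
  - (lambda_mul (act (prod a b i) v) (m - i + n) *+ 'C(m - i + n, n))
  + act (lambda_mul (prod a b) i) v (m - i + n) *+ 'C(m - i + n, n))); last first.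
  move=> i _; rewrite (sesqXr prod_sesq) actDl (sesqXl act_sesq).
  by rewrite mulrnDl mulNrn.
rewrite big_split sumrN /= [X in _ + X]big_ord_recl /=.
rewrite (sesq0l act_sesq) mul0rn add0r.
rewrite big_ord_recr /= subnn add0n binn mulr1n opprD addrAC.
have -> : \sum_(i < m) act (lambda_mul (prod a b) (bump 0 i)) v (m - bump 0 i + n)
    *+ 'C(m - bump 0 i + n, n)
  = \sum_(i < m) act (prod a b i) v (m - i.+1 + n) *+ 'C(m - i.+1 + n, n).
  by apply: eq_bigr.
rewrite -sumrN -big_split /=.
case: n => [|n] /=.
  rewrite (sesq0r act_sesq). rewrite oppr0 big1 => [|i _].
    by rewrite addr0.
  by rewrite -[(m - i)%N]prednK ?subn_gt0 // -subnS !addn0 !bin0 /= addNr.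
rewrite H big_ord_recr /= subnn add0n binn mulr1n opprD; congr (_ - _).
rewrite -sumrN; apply: eq_bigr => i _.
rewrite -[(m - i)%N]prednK ?subn_gt0 // -subnS !addSn !addnS /= binS mulrnDr.
by rewrite opprD addrAC addNr add0r.
Qed.

(** Both sides acquire the factor [d + lambda + mu]; multiplication by [lambda + mu] is again
    Pascal's rule. *)
Lemma assoc_atXr a b v : assoc_at a b v -> assoc_at a b ('X *: v).
Proof.
move=> H m n; rewrite (sesqXr act_sesq) actDr (sesqXr act_sesq).
rewrite (eq_bigr (fun i : 'I_m.+1 =>
  'X *: (act (prod a b i) v (m - i + n) *+ 'C(m - i + n, n))
  + lambda_mul (act (prod a b i) v) (m - i + n) *+ 'C(m - i + n, n))); last first.
  by move=> i _; rewrite (sesqXr act_sesq) mulrnDl scalerMnr.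
rewrite big_split /= -scaler_sumr -H -addrA; congr (_ + _).
rewrite [RHS]big_ord_recr /= subnn add0n binn mulr1n.
have -> : lambda_mul (act a (act b v n)) m = \sum_(i < m)
    act (prod a b i) v (m - i.+1 + n) *+ 'C(m - i.+1 + n, n).
  case: m => [|m] /=; first by rewrite big_ord0.
  by rewrite H; apply: eq_bigr => i _; rewrite subSS.
case: n => [|n] /=.
  rewrite (sesq0r act_sesq) !addr0; apply: eq_bigr => i _.
  by rewrite !addn0 -[(m - i)%N]prednK ?subn_gt0 // -subnS !bin0.
rewrite H big_ord_recr /= subnn add0n binn mulr1n addrA -big_split /=.
congr (_ + _); apply: eq_bigr => i _.
by rewrite -[(m - i)%N]prednK ?subn_gt0 // -subnS !addSn !addnS /= [in RHS]binS [in RHS]mulrnDr.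
Qed.

End ConfAssoc.

(** * Current conformal algebras and the action on [H (x) P] *)

Section HtensorTheory.
Variables (k : fieldType) (M : algType k).
Implicit Types p q : Htensor M.

Definition hcoef p (i : nat) : M := (p : {poly M})`_i.

Lemma hcoefP p q : (forall i, hcoef p i = hcoef q i) -> p = q.
Proof. by move=> pq; apply/polyP. Qed.

Lemma hcoefD p q i : hcoef (p + q) i = hcoef p i + hcoef q i.
Proof. exact: coefD. Qed.

Lemma hcoefN p i : hcoef (- p) i = - hcoef p i.
Proof. exact: coefN. Qed.

Lemma hcoef0 i : hcoef 0 i = 0.
Proof. exact: coef0. Qed.

Lemma hcoefC c p i : hcoef (c%:P *: p) i = c *: hcoef p i.
Proof. by rewrite /hcoef [_ *: p]/(Hscale _ p) /Hscale map_polyC coefCM mulr_algl. Qed.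

Lemma hcoefX p i : hcoef ('X *: p) i = if i is j.+1 then hcoef p j else 0.
Proof.
rewrite /hcoef [_ *: p]/(Hscale _ p) /Hscale map_polyX -commr_polyX coefMX.
by case: i.
Qed.

Lemma hcoef_Hten (w : M) i : hcoef (Hten w) i = if i is 0 then w else 0.
Proof. by rewrite /hcoef /Hten coefC; case: i. Qed.

Lemma Htensor_ind (S : Htensor M -> Prop) :
    (forall w, S (Hten w)) -> (forall p q, S p -> S q -> S (p + q)) ->
    (forall p, S p -> S ('X *: p)) ->
  forall p, S p.
Proof.
move=> S1 SD SX; elim/poly_ind => [|p c Sp]; first exact: (S1 0).
suff -> : p * 'X + c%:P = ('X *: (p : Htensor M)) + Hten c by apply: SD; [exact: SX|].
by congr (_ + _); rewrite [_ *: _]/(Hscale _ p) /Hscale map_polyX commr_polyX.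
Qed.

Lemma HtenD : {morph @Hten k M : x y / x + y}.
Proof. by move=> x y; apply: polyCD. Qed.

Lemma HtenZ c x : Hten (c *: x) = c%:P *: Hten x :> Htensor M.
Proof. by apply: hcoefP => i; rewrite hcoefC !hcoef_Hten; case: i => //; rewrite scaler0. Qed.

End HtensorTheory.

Section CurrentAction.
Variables (k : fieldType) (E M : algType k) (m : E -> M -> M).
Hypothesis m_bilin : is_bilinear m.

(* The coefficient of [lambda^n] in [a(-lambda) v(d + lambda)], where [E] acts
   on [M] by [m]; the [d]-degree of [v] bounds that of the result. *)
Definition cur_act (a : Htensor E) (v : Htensor M) (n : nat) : Htensor M :=
  \poly_(l < size (v : {poly M})) \sum_(i < n.+1)
    (-1) ^+ i *: (m (hcoef a i) (hcoef v (n - i + l)) *+ 'C(n - i + l, l)).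

Let m_linl y := m_bilin.2 y.
Let m_linr x := m_bilin.1 x.
Let m0r x : m x 0 = 0. Proof. exact: linear_function0 (m_linr x). Qed.
Let m0l y : m 0 y = 0. Proof. exact: linear_function0 (m_linl y). Qed.

(** The truncation at the size of [v] is harmless: beyond it every summand vanishes. *)
Lemma hcoef_cur_act a v n l : hcoef (cur_act a v n) l = \sum_(i < n.+1)
    (-1) ^+ i *: (m (hcoef a i) (hcoef v (n - i + l)) *+ 'C(n - i + l, l)).
Proof.
rewrite /hcoef coef_poly; case: ltnP => // le_vl; rewrite big1 // => i _.
rewrite [X in m _ X]nth_default ?m0r ?mul0rn ?scaler0 //.
exact: leq_trans le_vl (leq_addl _ _).
Qed.

Lemma cur_act_sesquilinear : is_sesquilinear cur_act.
Proof.
split=> [a v|c a b v n|c a v w n|a v n|a v n].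
- exists (size (a : {poly E}) + size (v : {poly M}))%N => n le_n.
  apply: hcoefP => l; rewrite hcoef_cur_act hcoef0 big1 // => i _.
  case: (leqP (size (a : {poly E})) i) => [le_i|lt_i].
    by rewrite [hcoef a i]nth_default // m0l mul0rn scaler0.
  rewrite [hcoef v _]nth_default ?m0r ?mul0rn ?scaler0 // ltnW //.
  rewrite ltn_addr // ltn_subRL (leq_trans _ le_n) //.
  by rewrite -addSn leq_add2r.
- apply: hcoefP => l; rewrite hcoefD hcoefC !hcoef_cur_act scaler_sumr -big_split.
  apply: eq_bigr => i _ /=; rewrite hcoefD hcoefC m_linl mulrnDl scalerDr.
  by rewrite !scalerMnr !scalerA mulrC.
- apply: hcoefP => l; rewrite hcoefD hcoefC !hcoef_cur_act scaler_sumr -big_split.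
  apply: eq_bigr => i _ /=; rewrite hcoefD hcoefC m_linr mulrnDl scalerDr.
  by rewrite !scalerMnr !scalerA mulrC.
- apply: hcoefP => l; rewrite hcoefN hcoef_cur_act big_ord_recl hcoefX m0l.
  rewrite mul0rn scaler0 add0r; case: n => [|n]; first by rewrite big_ord0 hcoef0 oppr0.
  rewrite hcoef_cur_act -sumrN; apply: eq_bigr => i _.
  by rewrite hcoefX /= subSS exprS mulN1r scaleNr.
- apply: hcoefP => l; rewrite hcoefD hcoefX hcoef_cur_act.
  case: n => [|n] /=.
    rewrite hcoef0 addr0 big_ord1 subnn add0n hcoefX binn mulr1n expr0 scale1r.
    by case: l => // l; rewrite hcoef_cur_act big_ord1 subnn add0n binn mulr1n expr0 scale1r.
  rewrite big_ord_recr /= hcoef_cur_act subnn add0n hcoefX binn mulr1n.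
  case: l => [|l].
    rewrite m0r scaler0 addr0 add0r; apply: eq_bigr => i _.
    by rewrite hcoefX !addn0 !bin0 subSn // -ltnS.
  rewrite hcoef_cur_act [X in _ = X + _]big_ord_recr /= subnn add0n binn mulr1n.
  rewrite addrAC -big_split; congr (_ + _); apply: eq_bigr => i _ /=.
  rewrite subSn -1?ltnS // hcoefX !addnS !addSn binS.
  by rewrite -scalerDr -mulrnDr; congr (_ *: (_ *+ _)); apply: addnC.
Qed.

Lemma cur_act_Hten x w n : cur_act (Hten x) (Hten w) n =
  if n is 0 then Hten (m x w) else 0.
Proof.
apply: hcoefP => l; rewrite hcoef_cur_act; case: n => [|n].
  rewrite big_ord1 subnn add0n !hcoef_Hten expr0 scale1r binn mulr1n.
  by case: l.
rewrite hcoef0 big1 // => i _; rewrite !hcoef_Hten; case: i => [[|i] lt_i] /=.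
  by rewrite m0r mul0rn scaler0.
by rewrite m0l mul0rn scaler0.
Qed.

End CurrentAction.

(** By the propagation lemmas all three arguments may be taken constant; then only the coefficient
    of [lambda^0 mu^0] is left, and it is the associativity of [m]. *)
Lemma cur_act_assoc (k : fieldType) (E M : algType k) (m1 : E -> E -> E)
    (m : E -> M -> M) :
    is_bilinear m1 -> is_bilinear m ->
    (forall x y w, m x (m y w) = m (m1 x y) w) ->
  is_conf_assoc (cur_act m1) (cur_act m).
Proof.
move=> m1_bilin m_bilin m_assoc.
have s1 := cur_act_sesquilinear m1_bilin; have s := cur_act_sesquilinear m_bilin.
elim/Htensor_ind => [x|a1 a2 IH1 IH2|a IH] b v;
  [|exact: (assoc_atDl s1 s (IH1 b v) (IH2 b v))|exact: (assoc_atXl s1 s (IH b v))].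
elim/Htensor_ind: b v => [y|b1 b2 IH1 IH2|b IH] v;
  [|exact: (assoc_atDm s1 s (IH1 v) (IH2 v))|exact: (assoc_atXm s1 s (IH v))].
elim/Htensor_ind: v => [w|v1 v2 IH1 IH2|v IH];
  [|exact: (assoc_atDr s IH1 IH2)|exact: (assoc_atXr s IH)].
move=> i n; rewrite (cur_act_Hten m_bilin) big_ord_recl /= subn0.
rewrite (cur_act_Hten m1_bilin) big1 ?addr0 => [|l _]; last first.
  by rewrite (cur_act_Hten m1_bilin) (sesq0l s) mul0rn.
rewrite (cur_act_Hten m_bilin); case: n => [|n].
  by rewrite (cur_act_Hten m_bilin) addn0 bin0 mulr1n m_assoc.
by rewrite addnS (sesq0r s) mul0rn.
Qed.

(** * The representation by Poisson brackets and multiplications *)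

Section PoissonAction.
Variables (k : fieldType) (g : lmodType k) (br : g -> g -> g).
Variables (P : algType k) (e : g -> P) (pb : P -> P -> P).
Hypothesis e_linear : linear e.
Hypothesis eC : forall a b, e a * e b = e b * e a.
Hypothesis pb_ext : is_poisson_extension br e pb.

Lemma nontrivial_alg : exists v : P, v <> 0.
Proof. by exists 1; apply/eqP/oner_neq0. Qed.

Notation E := (endo nontrivial_alg).

Let pb_lie : is_lie_bracket pb. Proof. by have [] := pb_ext. Qed.

Fact poisson_mul_linear a : linear (fun w => e a * w).
Proof. by move=> c x y; rewrite mulrDr scalerAr. Qed.

Definition poisson_ad a : E := Endo nontrivial_alg (br_linear_r pb_lie (e a)).
Definition poisson_mul a : E := Endo nontrivial_alg (poisson_mul_linear a).

Lemma poisson_ad_linear : linear poisson_ad.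
Proof.
by move=> c a b; apply: endoP => w /=; rewrite e_linear (br_linear_l pb_lie).
Qed.

Lemma poisson_mul_linear_letter : linear poisson_mul.
Proof. by move=> c a b; apply: endoP => w /=; rewrite e_linear mulrDl -scalerAl. Qed.

Lemma poisson_ad_ad a b :
  poisson_ad a * poisson_ad b - poisson_ad b * poisson_ad a = poisson_ad (br a b).
Proof.
have [_ _ pbe] := pb_ext; apply: endoP => w /=; rewrite -pbe.
by rewrite (br_jacobi pb_lie) (brC pb_lie (pb _ w)) [RHS]addrC.
Qed.

Lemma poisson_ad_mul a b :
  poisson_ad a * poisson_mul b - poisson_mul b * poisson_ad a
  = poisson_mul (br a b).
Proof.
have [_ pbM pbe] := pb_ext; apply: endoP => w.
have : pb (e a) (e b * w) - e b * pb (e a) w = e (br a b) * w.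
  by rewrite pbM pbe addrK.
by [].
Qed.

Lemma poisson_mul_brN a b : poisson_mul (br b a) = - poisson_mul (br a b).
Proof.
have [_ _ pbe] := pb_ext; apply: endoP => w.
have : e (br b a) * w = - (e (br a b) * w).
  by rewrite -!pbe (brC pb_lie (e b)) mulNr.
by [].
Qed.

Lemma poisson_mulC a b : poisson_mul a * poisson_mul b = poisson_mul b * poisson_mul a.
Proof. by apply: endoP => w /=; rewrite !mulrA eC. Qed.

Fact endo_mul_bilinear : is_bilinear (fun x y : E => x * y).
Proof.
split=> [x c y z|x c y z]; first by rewrite mulrDr scalerAr.
by rewrite mulrDl -scalerAl.
Qed.

Fact endo_eval_bilinear : is_bilinear (fun (x : E) (w : P) => x w).
Proof. by split=> [x|w c x y] //; apply: endo_linear. Qed.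

Fact endo_mul_conf_assoc :
  is_conf_assoc (cur_act (fun x y : E => x * y)) (cur_act (fun x y : E => x * y)).
Proof.
exact: cur_act_assoc endo_mul_bilinear endo_mul_bilinear (@mulrA E).
Qed.

Definition cur_endo : assocConfAlg k :=
  AssocConfAlg (cur_act_sesquilinear endo_mul_bilinear) endo_mul_conf_assoc.

(** In a left argument [d] acts as [- lambda], so the second term acts as [lambda] times
    multiplication by [e a]. *)
Definition cur_letter a : cur_endo :=
  Hten (poisson_ad a) - 'X *: (Hten (poisson_mul a) : Htensor E).

(** Expansion of [(ad a + lambda L_a) (ad b - (d + lambda) L_b)], whose degree 2 in [lambda]
    accounts for the locality level 3. *)
Lemma cur_letter_prod a b n : conf_prod (cur_letter a) (cur_letter b) n =
  match n with
  | 0 => Hten (poisson_ad a * poisson_ad b)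
         - 'X *: (Hten (poisson_ad a * poisson_mul b) : Htensor E)
  | 1 => Hten (poisson_mul a * poisson_ad b)
         - Hten (poisson_ad a * poisson_mul b)
         - 'X *: (Hten (poisson_mul a * poisson_mul b) : Htensor E)
  | 2 => - Hten (poisson_mul a * poisson_mul b)
  | _ => 0
  end.
Proof.
have s := cur_act_sesquilinear endo_mul_bilinear.
have c := cur_act_Hten endo_mul_bilinear.
rewrite /= /cur_letter (sesqDl s) !(sesqDr s) (sesqNl s) !(sesqNr s) (sesqNl s).
rewrite !(sesqXl s) !(sesqXr s) !c.
case: n => [|[|[|[|n]]]] /=; rewrite ?(sesqXr s) ?c /=
  ?(scaler0, oppr0, opprK, add0r, addr0, subr0) // ?c ?oppr0 //.
by rewrite addrA [- _ + _]addrC.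
Qed.

(** Compared by powers of [lambda] and [d], the commutator identity reduces to [[ad a, ad b] = ad
    [a, b]], [[ad a, L_b] = L_[a, b]] and [[L_a, L_b] = 0]. *)
Lemma cur_letter_rep (X : g -> Prop) : is_cur_rep br X 3 cur_letter.
Proof.
split=> [c a b|a b _ _ n|a b _ _ n].
- rewrite /cur_letter poisson_ad_linear poisson_mul_linear_letter !HtenD !HtenZ.
  by rewrite scalerDr scalerA mulrC -scalerA scalerBr opprD addrACA.
- by rewrite cur_letter_prod; case: n => [|[|[|n]]].
rewrite /conf_commutator cur_letter_prod.
move: (cur_letter_prod b a); set D := conf_prod _ _ => DE.
have X2 (z : Htensor E) : 'X^2 *: z = 'X *: ('X *: z) by rewrite scalerA.
have xx := poisson_ad_ad a b; have xy := poisson_ad_mul a b.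
have yx : poisson_mul a * poisson_ad b - poisson_ad b * poisson_mul a
    = poisson_mul (br a b).
  by rewrite -opprB poisson_ad_mul poisson_mul_brN opprK.
have yy := poisson_mulC a b.
rewrite big_mkcond !big_ord_recr big_ord0 /= add0r !DE.
have hE := (hcoefD, hcoefN, hcoefX, hcoef_Hten).
have XN (z : Htensor E) : (- 'X) *: z = - ('X *: z) by rewrite scaleNr.
case: n => [|[|[|n]]] /=.
- rewrite !bin0 !mulr1n expr0 expr1 !mul1r mulN1r sqrrN expr1n mul1r scale1r XN X2.
  apply: hcoefP => -[|[|[|l]]]; rewrite !hE ?(addr0, add0r, subr0, sub0r, oppr0, opprK) //.

  + by rewrite opprD !opprK [X in _ + X]addrC subrK -xy opprB addrC.
  + by rewrite subrr oppr0.
- rewrite !bin1 expr1 sqrrN expr1n mulr1n !subnn expr0 !mulr1 scaleN1r add0r.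
  rewrite -[(2 - 1)%N]/1%N expr1 mulr_natl mulr2n scalerDl.
  apply: hcoefP => -[|[|l]]; rewrite !hE ?(addr0, add0r, subr0, sub0r, oppr0, opprK) //.
  + rewrite [X in _ + X]addrC addrACA yx [- (poisson_ad a * _) + _]addrC.
    by rewrite -opprB xy addrN.
  + by rewrite yy addrA subrr add0r opprK addNr.
- rewrite subnn binn mulr1n expr0 mulr1 sqrrN expr1n scale1r add0r.
  by apply: hcoefP => -[|l]; rewrite !hE ?(addr0, add0r, subr0, sub0r, oppr0, opprK) // yy addNr.
- by rewrite ?(addr0, add0r, subr0, sub0r, oppr0, opprK).
Qed.

Lemma cur_letter_act a w n :
  cur_act (fun (x : E) (v : P) => x v) (cur_letter a) (Hten w) n =
  match n with
  | 0 => Hten (pb (e a) w)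
  | 1 => Hten (e a * w)
  | _ => 0
  end.
Proof.
have s := cur_act_sesquilinear endo_eval_bilinear.
have c := cur_act_Hten endo_eval_bilinear.
rewrite /cur_letter (sesqDl s) (sesqNl s) (sesqXl s) opprK.
by case: n => [|[|n]] /=; rewrite ?c ?addr0 ?add0r.
Qed.

Lemma poisson_action_exists (X : g -> Prop) (U : assocConfAlg k) (iota : g -> U) :
    is_cur_envelope br X 3 iota ->
  exists act : U -> Htensor P -> nat -> Htensor P,
    is_conf_module act /\ is_poisson_action iota e pb act.
Proof.
move=> [_ _ /(_ _ _ (cur_letter_rep X)) [f [[f_lin fM] f_letter _]]].
have s := cur_act_sesquilinear endo_eval_bilinear.
exists (fun u => cur_act (fun (x : E) (v : P) => x v) (f u)); split; last first.
  by move=> a w n; rewrite f_letter cur_letter_act.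
have [s1 s2 s3 s4 s5] := s.
split.
  split=> [u v|c u u' v n|c u v v' n|u v n|u v n].
  - exact: s1.
  - by rewrite f_lin s2.
  - exact: s3.
  - by rewrite (linear_functionZ f_lin) s4.
  - exact: s5.
move=> u u' v m n; rewrite (cur_act_assoc endo_mul_bilinear endo_eval_bilinear) //.
by apply: eq_bigr => i _; rewrite fM.
Qed.

End PoissonAction.

(** * Modules satisfying the relations *)

Lemma basis_ind (k : fieldType) (g : lmodType k) (X S : g -> Prop) :
    is_linear_basis X -> (forall x, X x -> S x) -> S 0 ->
    (forall c x y, S x -> S y -> S (c *: x + y)) ->
  forall x, S x.
Proof.
move=> [_ X_span] SX S0 SL x; have [s [c [sX ->]]] := X_span x.
rewrite big_seq; elim/big_rec: _ => // y z ys Sz.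
by apply: SL => //; apply/SX/sX.
Qed.

Lemma poly_scale_ind (k : fieldType) (V : lmodType {poly k}) (S : V -> Prop) :
    (forall x y, S x -> S y -> S (x + y)) ->
    (forall c x, S x -> S (c%:P *: x)) -> (forall x, S x -> S ('X *: x)) ->
  forall h x, S x -> S (h *: x).
Proof.
move=> SD SC SX; elim/poly_ind => [|h c IH] x Sx.
  by rewrite -polyC0; apply: SC.
by rewrite scalerDl -scalerA; apply: SD; [apply/IH/SX|apply: SC].
Qed.

(* [W] as a vector space over [k], embedded in [k[d]] as the constants. *)
Definition base_module (k : fieldType) (W : lmodType {poly k}) : Type := W.

Section BaseModule.
Variables (k : fieldType) (W : lmodType {poly k}).

HB.instance Definition _ := GRing.Zmodule.on (base_module W).

Definition base_scale (c : k) (x : base_module W) : base_module W :=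
  c%:P *: (x : W).

Fact base_scaleA c d x : base_scale c (base_scale d x) = base_scale (c * d) x.
Proof. by rewrite /base_scale scalerA polyCM. Qed.

Fact base_scale1 : left_id 1 base_scale.
Proof. by move=> x; rewrite /base_scale polyC1 scale1r. Qed.

Fact base_scaleDr : right_distributive base_scale +%R.
Proof. by move=> c x y; apply: scalerDr. Qed.

Fact base_scaleDl x : {morph base_scale^~ x : c d / c + d}.
Proof. by move=> c d; rewrite /base_scale polyCD scalerDl. Qed.

HB.instance Definition _ := GRing.Zmodule_isLmodule.Build k (base_module W)
  base_scaleA base_scale1 base_scaleDr base_scaleDl.

End BaseModule.

Section Relations.
Variables (k : fieldType) (g : lmodType k) (br : g -> g -> g) (X : g -> Prop).
Hypothesis char0 : [pchar k] =i pred0.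
Hypothesis br_lie : is_lie_bracket br.
Hypothesis X_basis : is_linear_basis X.
Variables (U : assocConfAlg k) (iota : g -> U).
Hypothesis iota_rep : is_cur_rep br X 3 iota.
Variables (W : lmodType {poly k}) (act : U -> W -> nat -> W).
Hypothesis act_mod : is_conf_module act.

Let act_sesq : is_sesquilinear act. Proof. by have [] := act_mod. Qed.
Let act_assoc : is_conf_assoc (@conf_prod k U) act. Proof. by have [] := act_mod. Qed.

(** Associativity expresses both double actions through the coefficients [c] and [d] of the products
    of [iota a] and [iota b] in the two orders. By locality only three of each matter, and the
    commutator relation gives [c] in terms of [d] and [[a, b]]. *)
Lemma commutator_basis a b v m : X a -> X b ->
  act (iota a) (act (iota b) v 1) m
  = act (iota b) (act (iota a) v m) 1 + act (iota (br a b)) v m.+1 *+ m.+1.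
Proof.
move=> Xa Xb; have [_ loc comm] := iota_rep.
have := comm a b Xa Xb; have := loc a b Xa Xb; have := loc b a Xb Xa.
rewrite /conf_commutator !act_assoc.
set c := conf_prod (iota a) _; set d := conf_prod (iota b) _ => d_loc c_loc cd.
have X2 (z : U) : 'X^2 *: z = 'X *: ('X *: z) by rewrite scalerA.
have XN (z : U) : (- 'X) *: z = - ('X *: z) by rewrite scaleNr.
have c0 : c 0%N = d 0%N - 'X *: d 1%N + 'X *: ('X *: d 2) + iota (br a b).
  have /eqP := cd 0%N; rewrite big_mkcond !big_ord_recr big_ord0 /=.
  rewrite !bin0 !mulr1n expr0 expr1 !mul1r mulN1r sqrrN expr1n mul1r scale1r XN X2.
  by rewrite subr_eq add0r [_ + iota _]addrC => /eqP.
have c1 : c 1%N = - d 1%N + 'X *: d 2 *+ 2.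
  have /eqP := cd 1%N; rewrite big_mkcond !big_ord_recr big_ord0 /=.
  rewrite !bin1 expr1 sqrrN expr1n mulr1n !subnn expr0 !mulr1 scaleN1r !add0r.
  rewrite -[(2 - 1)%N]/1%N expr1 mulr_natl -scalerMnl.
  by rewrite subr_eq add0r => /eqP.
have c2 : c 2 = d 2.
  have /eqP := cd 2; rewrite big_mkcond !big_ord_recr big_ord0 /=.
  rewrite subnn binn mulr1n expr0 mulr1 sqrrN expr1n scale1r !add0r.
  by rewrite subr_eq add0r => /eqP.
have e0 n : act (c 0%N) v n = act (d 0%N) v n + lambda_mul (act (d 1%N) v) n
    + lambda_mul (lambda_mul (act (d 2) v)) n + act (iota (br a b)) v n.
  rewrite c0 !(sesqDl act_sesq) (sesqNl act_sesq) !(sesqXl act_sesq) opprK.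
  congr (_ + _ + _); case: n => [|n] /=; first by rewrite oppr0.
  by rewrite (sesqXl act_sesq) opprK.
have e1 n : act (c 1%N) v n
    = - act (d 1%N) v n - lambda_mul (act (d 2) v) n *+ 2.
  rewrite c1 (sesqDl act_sesq) (sesqNl act_sesq) mulr2n (sesqDl act_sesq).
  by rewrite !(sesqXl act_sesq) mulr2n opprD.
have c_vanish i n : act (c i.+3) v n = 0.
  by rewrite c_loc // (sesq0l act_sesq).
(* The exponent 1 of [mu] gives [c 0], [c 1], [c 2] the multiplicities [m + 1], [m], [m - 1]. Thus
   [d 1] is left with their first difference, which is 1, and [d 2] with their second difference,
   which is 0. Here [m = n + 1]. *)
have ac (x y z t : W) n : (x + y + z + t) *+ n.+2
    + ((- y - z *+ 2) *+ n.+1 + z *+ n) = x *+ n.+2 + y + t *+ n.+2.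
  have zz : z *+ 2 *+ n.+1 = z *+ n.+2 + z *+ n.
    by rewrite -mulrnDr -mulrnA mul2n doubleS -addnn.
  rewrite !mulrnDl !mulNrn zz [y *+ n.+2]mulrSr opprD.
  rewrite (AC ((1*2*1*1)*((1*2)*1)) ((1*3*5)*((2*6)*(4*7)*(8*9)))).
  by rewrite /= !addrN addNr !addr0.
have b1 : bump 0 0 = 1%N by [].
have b2 : bump 0 (bump 0 0) = 2 by [].
rewrite [in RHS]big_ord_recl big_ord1 /= subn0 add1n subnn add0n binSn binn mulr1n.
case: m => [|[|m]].
- by rewrite big_ord1 /= e0 /= addr0.
- rewrite big_ord_recl big_ord1 /= e0 e1 /= !bin1.
  by have := ac (act (d 0%N) v 2) (act (d 1%N) v 1) (act (d 2) v 0)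
    (act (iota (br a b)) v 2) 0%N; rewrite mulr1n mulr0n addr0.
- rewrite !big_ord_recl big1 => [|i _]; last by rewrite c_vanish mul0rn.
  rewrite /= e0 e1 /= c2 !bin1 b1 b2 !subSS !subn0 !addn1 addr0.
  exact: ac.
Qed.

Let letter_ind S := @basis_ind k g X S X_basis.

Lemma iotaL c x y : iota (c *: x + y) = c%:P *: iota x + iota y.
Proof. by have [] := iota_rep. Qed.

Lemma iotaD x y : iota (x + y) = iota x + iota y.
Proof. by have := iotaL 1 x y; rewrite polyC1 !scale1r. Qed.

Lemma iota0 : iota 0 = 0.
Proof. exact: additive_function0 iotaD. Qed.

Lemma act_iotaL c x y v n :
  act (iota (c *: x + y)) v n = c%:P *: act (iota x) v n + act (iota y) v n.
Proof. by rewrite iotaL (sesqDl act_sesq) (sesqCl act_sesq). Qed.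

Lemma act_iota0 v n : act (iota 0) v n = 0.
Proof. by rewrite iota0 (sesq0l act_sesq). Qed.

Lemma commutator a b v m : act (iota a) (act (iota b) v 1) m
  = act (iota b) (act (iota a) v m) 1 + act (iota (br a b)) v m.+1 *+ m.+1.
Proof.
elim/letter_ind: a v m => [a Xa||c a1 a2 IH1 IH2] v m.
- elim/letter_ind: b v m => [b Xb||c b1 b2 IH1 IH2] v m.
  + exact: commutator_basis.
  + by rewrite (linear_function0 (br_linear_r br_lie a)) !act_iota0
      (sesq0r act_sesq) mul0rn addr0.
  + rewrite br_linear_r // !act_iotaL (sesqDr act_sesq) (sesqCr act_sesq) IH1 IH2.
    by rewrite mulrnDl scalerMnr scalerDr addrACA.
- by rewrite (linear_function0 (br_linear_l br_lie b)) !act_iota0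
    (sesq0r act_sesq) mul0rn addr0.
- rewrite br_linear_l // !act_iotaL (sesqDr act_sesq) (sesqCr act_sesq) IH1 IH2.
  by rewrite mulrnDl scalerMnr scalerDr addrACA.
Qed.

Variable w : W.
Hypothesis w_killed : killed_by_relations iota X act w.

(** Characteristic zero removes the factor [n!] of [Lop], and linearity passes from the basis to all
    of [g]. *)
Lemma killed_letter a n : n != 1%N -> act (iota a) w n = 0.
Proof.
move=> n1; elim/letter_ind: a => [a Xa||c a b IHa IHb].
- have := w_killed Xa n1; rewrite /Lop -scaler_nat -polyC_natr => /(congr1 (GRing.scale (n`!%:R^-1)%:P)).
  rewrite scalerA -polyCM mulVf ?polyC1 ?scale1r ?scaler0 //.
  by rewrite ((pcharf0P k).1 char0) -lt0n fact_gt0.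
- exact: act_iota0.
- by rewrite act_iotaL IHa IHb scaler0 addr0.
Qed.

Definition word_act (s : seq g) : base_module W :=
  foldr (fun a v => act (iota a) v 1) w s.

Lemma word_act_cat s t :
  word_act (s ++ t) = foldr (fun a v => act (iota a) v 1) (word_act t) s.
Proof. exact: foldr_cat. Qed.

(** Induction on the word for all [n] at once: past the first letter, [commutator] leaves the
    indices [n] and [n.+1] on a shorter word. *)
Lemma word_act_high s a n : (1 < n)%N -> act (iota a) (word_act s) n = 0.
Proof.
elim: s a n => [|b s IH] a n n1 /=; first by rewrite killed_letter // gtn_eqF.
by rewrite commutator !IH ?(sesq0r act_sesq) ?mul0rn ?addr0 // ltnW.
Qed.

(** For [m = 1] the extra term in [commutator] has index 2 and vanishes on words. *)
Lemma word_act_swap u v x y :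
  word_act (u ++ x :: y :: v) = word_act (u ++ y :: x :: v).
Proof.
rewrite !word_act_cat; congr (foldr _ _ u).
by rewrite /= commutator (word_act_high v (br x y)) // mul0rn addr0.
Qed.

Lemma word_act_multilinear : multilinear_word word_act.
Proof.
move=> u v c x y; rewrite !word_act_cat; elim: u => [|a u IH] /=.
  by rewrite act_iotaL.
by rewrite IH [LHS](sesqDr act_sesq) [X in X + _](sesqCr act_sesq).
Qed.

End Relations.

(** * Extension of linear maps from [P] to [H (x) P] *)

Section UniversalMap.
Variables (k : fieldType) (P : algType k) (W : lmodType {poly k}) (f : P -> W).
Hypothesis f_linear : forall c x y, f (c *: x + y) = c%:P *: f x + f y.

Let fD : {morph f : x y / x + y}.
Proof. by move=> x y; have := f_linear 1 x y; rewrite polyC1 !scale1r. Qed.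

Let f0 : f 0 = 0. Proof. exact: additive_function0 fD. Qed.

Definition Hextend (p : Htensor P) : W :=
  \sum_(i < size (p : {poly P})) 'X^i *: f (hcoef p i).

Lemma HextendE N (p : Htensor P) : (size (p : {poly P}) <= N)%N ->
  Hextend p = \sum_(i < N) 'X^i *: f (hcoef p i).
Proof.
move=> le_N; rewrite /Hextend.
rewrite (big_ord_widen N (fun i => 'X^i *: f (hcoef p i)) le_N) big_mkcond.
apply: eq_bigr => i _; case: ltnP => // le_i.
by rewrite /hcoef nth_default // f0 scaler0.
Qed.

Lemma HextendD : {morph Hextend : p q / p + q}.
Proof.
move=> p q; pose N := maxn (size (p : {poly P})) (size (q : {poly P})).
rewrite (HextendE (leq_maxl _ _ : (_ <= N)%N)) (HextendE (leq_maxr _ _ : (_ <= N)%N)).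
rewrite (@HextendE N) ?size_polyD // -big_split; apply: eq_bigr => i _ /=.
by rewrite hcoefD fD scalerDr.
Qed.

Lemma HextendX p : Hextend ('X *: p) = 'X *: Hextend p.
Proof.
pose N := size (p : {poly P}).
have le_N : (size ('X *: p : {poly P}) <= N.+1)%N.
  apply/leq_sizeP => i lt_i; rewrite -[LHS]/(hcoef _ i) hcoefX.
  by case: i lt_i => // i lt_i; rewrite /hcoef nth_default.
rewrite (HextendE le_N) big_ord_recl hcoefX f0 scaler0 add0r scaler_sumr.
by apply: eq_bigr => i _; rewrite hcoefX exprS scalerA.
Qed.

Lemma HextendC c p : Hextend (c%:P *: p) = c%:P *: Hextend p.
Proof.
have fC x : f (c *: x) = c%:P *: f x.
  by have := f_linear c x 0; rewrite f0 !addr0.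
rewrite (@HextendE (size (p : {poly P}))); last first.
  by apply/leq_sizeP => i le_i; rewrite -[LHS]/(hcoef _ i) hcoefC /hcoef nth_default ?scaler0.
rewrite scaler_sumr; apply: eq_bigr => i _.
by rewrite hcoefC fC !scalerA mulrC.
Qed.

Lemma Hextend_Hten x : Hextend (Hten x) = f x.
Proof.
rewrite (@HextendE 1) ?size_polyC ?leq_b1 // big_ord1 hcoef_Hten expr0.
by rewrite scale1r.
Qed.

Lemma Hextend_linear : linear Hextend.
Proof.
have HextendZ h : forall p, Hextend (h *: p) = h *: Hextend p.
  elim/poly_ind: h => [|h c IH] p.
    by rewrite -polyC0 HextendC.
  by rewrite !scalerDl HextendD HextendC -!scalerA IH HextendX.
by move=> h p q; rewrite HextendD HextendZ.
Qed.

End UniversalMap.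

(** * Module homomorphisms checked on generators of [U] *)

Section Homomorphism.
Variables (k : fieldType) (g : lmodType k) (br : g -> g -> g) (X : g -> Prop).
Variables (U : assocConfAlg k) (iota : g -> U).
Hypothesis iota_gen : conf_generates (fun u => exists2 a, X a & u = iota a).
Variables (V W : lmodType {poly k}).
Variables (actV : U -> V -> nat -> V) (actW : U -> W -> nat -> W).
Hypotheses (actV_mod : is_conf_module actV) (actW_mod : is_conf_module actW).
Variable f : V -> W.
Hypothesis f_linear : linear f.
Hypothesis f_letter : forall a v n, f (actV (iota a) v n) = actW (iota a) (f v) n.

Lemma hom_of_generators : is_conf_module_hom actV actW f.
Proof.
split=> // u; have [sV aV] := actV_mod; have [sW aW] := actW_mod.
have fD x y := linear_functionD f_linear x y.
have fZ h x := linear_functionZ f_linear h x.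
have fN x : f (- x) = - f x by rewrite -scaleN1r fZ scaleN1r.
have f0 := linear_function0 f_linear.
elim/iota_gen: u => [u [a _ ->]||u u' IH IH'|h u|u u' n IH IH'] //.
- by move=> v n; rewrite (sesq0l sV) (sesq0l sW).
- by move=> v n; rewrite (sesqDl sV) (sesqDl sW) fD IH IH'.
- move: h u; apply: poly_scale_ind => [u u' IH IH'|c u IH|u IH] v n.
  + by rewrite (sesqDl sV) (sesqDl sW) fD IH IH'.
  + by rewrite (sesqCl sV) (sesqCl sW) fZ IH.
  + rewrite (sesqXl sV) (sesqXl sW) fN; congr (- _).
    by case: n => [|n] //=; rewrite IH.
(* The top term [i = m] of the associativity relation isolates the product
   [u (m) u'], with coefficient [C(n, n) = 1]. *)
- elim/ltn_ind: n => m IHm v n.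
  have := congr1 f (aV u u' v m n); rewrite IH IH' aW.
  rewrite linear_function_sum // big_ord_recr [RHS]big_ord_recr /=.
  rewrite subnn add0n binn !mulr1n => /esym.
  rewrite (eq_bigr (fun i : 'I_m =>
    actW (conf_prod u u' i) (f v) (m - i + n) *+ 'C(m - i + n, n))).
    by move/addrI.
  by move=> i _; rewrite (additive_functionMn fD) IHm.
Qed.

End Homomorphism.

(** * The universal property of [H (x) P(g)] *)

Section Main.
Variables (k : fieldType) (g : lmodType k) (br : g -> g -> g) (X : g -> Prop).
Hypothesis char0 : [pchar k] =i pred0.
Hypothesis br_lie : is_lie_bracket br.
Hypothesis X_basis : is_linear_basis X.
Variables (U : assocConfAlg k) (iota : g -> U).
Hypothesis U_env : is_cur_envelope br X 3 iota.
Variables (Ug : algType k) (j : g -> Ug).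
Hypothesis Ug_env : is_lie_envelope br j.
Variables (P : algType k) (sigma : nat -> Ug -> P).
Hypothesis P_gr : is_assoc_graded (canonical_filtration j) sigma.
Notation e := (fun a : g => sigma 1%N (j a)).
Variable pb : P -> P -> P.
Hypothesis pb_ext : is_poisson_extension br e pb.
Variable act : U -> Htensor P -> nat -> Htensor P.
Hypothesis act_mod : is_conf_module act.
Hypothesis act_letter : is_poisson_action iota e pb act.

Lemma letter_linear : linear e.
Proof.
have [sl _ _ _ _] := P_gr; have [[j_lin _] _] := Ug_env => c x y.
by rewrite j_lin sl //; apply: filtration_letter.
Qed.

Lemma poisson_bracket1 a : pb a 1 = 0.
Proof.
have [_ pbM _] := pb_ext; have := pbM a 1 1; rewrite !mulr1 mul1r => pb11.
by apply: (addrI (pb a 1)); rewrite -pb11 addr0.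
Qed.

(** The coefficient of [lambda] in the action of a letter is multiplication by it, so every product
    of letters is reached from 1. *)
Lemma Hten1_generates : conf_module_generated act (Hten 1).
Proof.
move=> S S1 S0 SD SZ SA; apply: Htensor_ind => [x|//|p /(SZ 'X)//].
elim/(graded_ind P_gr): x => [s|c x y Sx Sy].
  elim: s => [|a s IH]; first by rewrite big_nil.
  by rewrite big_cons -[Hten _](act_letter a _ 1); apply: SA.
by rewrite HtenD HtenZ; apply/SD/Sy/SZ.
Qed.

Lemma Hten1_killed : killed_by_relations iota X act (Hten 1).
Proof.
move=> a n Xa n1; rewrite /Lop act_letter; case: n n1 => [|[|n]] // _.
  by rewrite poisson_bracket1 [Hten 0]polyC0 mul0rn.
by rewrite mul0rn.
Qed.

Lemma hom_exists (W : lmodType {poly k}) (actW : U -> W -> nat -> W) (w : W) :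
    is_conf_module actW -> killed_by_relations iota X actW w ->
  exists f : Htensor P -> W, is_conf_module_hom act actW f /\ f (Hten 1) = w.
Proof.
move=> actW_mod w_killed; have [iota_rep iota_gen _] := U_env.
have [sW _] := actW_mod; have [sP _] := act_mod.
have word_lin := word_act_multilinear iota_rep actW_mod w.
have word_swap := word_act_swap char0 br_lie X_basis iota_rep actW_mod w_killed.
have [f [f_linear f_mon]] := graded_functional Ug_env P_gr char0 br_lie word_lin word_swap.
have f_lin c x y : f (c *: x + y) = c%:P *: (f x : W) + f y by apply: f_linear.
have f_mul a x : f (e a * x) = actW (iota a) (f x) 1.
  elim/(graded_ind P_gr): x => [s|c x y IHx IHy].
    by have := f_mon (a :: s); rewrite big_cons f_mon.
  rewrite mulrDr -scalerAr !f_lin IHx IHy.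
  by rewrite [RHS](sesqDr sW) (sesqCr sW).
have [pb_lie pbM pbe] := pb_ext.
(* On words both sides follow the same recursion: the Leibniz rule on the left, and on the right
   [commutator] with [m = 0], whose extra term is the action of [[a, b]] with index 1. *)
have f_pb a x : f (pb (e a) x) = actW (iota a) (f x) 0.
  elim/(graded_ind P_gr): x => [s|c x y IHx IHy]; last first.
    rewrite (br_linear_r pb_lie) !f_lin IHx IHy.
    by rewrite [RHS](sesqDr sW) (sesqCr sW).
  elim: s => [|b s IH].
    rewrite big_nil poisson_bracket1 (linear_function0 f_linear).
    have := f_mon [::]; rewrite big_nil => ->.
    by rewrite (killed_letter char0 X_basis iota_rep actW_mod w_killed).
  rewrite big_cons pbM pbe (linear_functionD f_linear) !f_mul IH.
  rewrite [RHS](commutator br_lie X_basis iota_rep actW_mod) addrC.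
  by rewrite mulr1n.
have f_high a x n : (1 < n)%N -> actW (iota a) (f x) n = 0.
  move=> n1; elim/(graded_ind P_gr): x => [s|c x y IHx IHy].
    by rewrite f_mon (word_act_high char0 br_lie X_basis iota_rep actW_mod w_killed).
  by rewrite f_lin (sesqDr sW) (sesqCr sW) IHx IHy scaler0 addr0.
pose F : Htensor P -> W := @Hextend k P W f.
have F_lin : linear F := Hextend_linear f_lin.
have F_Hten x : F (Hten x) = f x := Hextend_Hten f_lin x.
have FD p q : F (p + q) = F p + F q := HextendD f_lin p q.
have FX p : F ('X *: p) = 'X *: F p := HextendX f_lin p.
have F0 : F 0 = 0 := linear_function0 F_lin.
exists F; split; last by rewrite F_Hten; have := f_mon [::]; rewrite big_nil.
(* Only letters acting on constants [Hten x] have to be compared, which [f_pb], [f_mul] and [f_high]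
   do; sums and multiplication by [d] obey the same rules in both modules. *)
apply: (hom_of_generators iota_gen) => // a; elim/Htensor_ind => [x|p q IHp IHq|p IHp] n.
- rewrite act_letter F_Hten.
  by case: n => [|[|n]] /=; rewrite ?F_Hten ?f_pb ?f_mul // f_high // (linear_function0 f_linear).
- by rewrite (sesqDr sP) !FD (sesqDr sW) IHp IHq.
- rewrite (sesqXr sP) FD !FX (sesqXr sW) IHp; congr (_ + _).
  by case: n => [|n] /=; rewrite ?F0.
Qed.

End Main.

Theorem mainTheorem4 (k : fieldType) (char0 : [pchar k] =i pred0)
  (g : lmodType k) (br : g -> g -> g) (br_lie : is_lie_bracket br)
  (X : g -> Prop) (X_basis : is_linear_basis X)
  (U : assocConfAlg k) (iota : g -> U)
  (U_env : is_cur_envelope br X 3 iota)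
  (Ug : algType k) (j : g -> Ug) (Ug_env : is_lie_envelope br j)
  (P : algType k) (sigma : nat -> Ug -> P)
  (P_gr : is_assoc_graded (canonical_filtration j) sigma)
  (pb : P -> P -> P)
  (pb_ext : is_poisson_extension br (fun a : g => sigma 1%N (j a)) pb) :
  exists act : U -> Htensor P -> nat -> Htensor P,
    [/\ is_conf_module act,
        is_poisson_action iota (fun a : g => sigma 1%N (j a)) pb act
      & defined_by_relations iota X act (Hten 1)].
Proof.
have e_lin := letter_linear Ug_env P_gr.
have eC := graded_letterC Ug_env P_gr.
have [act [act_mod act_letter]] := poisson_action_exists e_lin eC pb_ext U_env.
exists act; split=> //.
have gen := Hten1_generates P_gr act_letter.
split=> //; first exact: (Hten1_killed pb_ext act_letter).
move=> W actW w actW_mod w_killed.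
have [f [f_hom f1]] := hom_exists char0 br_lie X_basis U_env Ug_env P_gr pb_ext
  act_mod act_letter actW_mod w_killed.
exists f; split=> // f' [f'_lin f'_act] f'1; have [f_lin f_act] := f_hom.
(* Uniqueness: the elements on which [f'] and [f] agree form a submodule that contains the
   generator. *)
elim/gen => [||p q IHp IHq|h p IH|u p n IH].
- by rewrite f'1 f1.
- by rewrite !linear_function0.
- by rewrite !linear_functionD // IHp IHq.
- by rewrite !linear_functionZ // IH.
- by rewrite f'_act f_act IH.
Qed.
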